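(* Let $\mathcal L=\mathcal L_0+\mathcal L_1$ and $\mathcal N$ be as described in the context. (1) Suppose $s$ satisfies $\min\{0,-\ell+p\}\le s\le\max\{2p,p+\ell\}$. Then there exists a constant $c=c(\mathcal L,s)$ such that for every $\epsilon>0$, if $N>c\,\epsilon^{1/(p-k)}$, then no eigenvalue of $\mathcal L_0+\mathcal P_N\mathcal L_1$, restricted to $\operatorname{ran}\mathcal P_N$, lies in $\rho_\epsilon(\mathcal L;H^s(\mathbb T),H^{s-k}(\mathbb T))$. (2) Suppose $\lambda$ is an isolated eigenvalue of $\mathcal L$, define $\mathcal K(z)$ by $\mathrm{id}-\mathcal K(z)=\mathcal N(\mathcal L_0+\mathcal L_1-z\,\mathrm{id})$, and let $\delta=\delta(N,\lambda)=O(1)$ as $N\to\infty$ be such that, for some $0\le t\le k+\ell$, as $N\to\infty$, $$\max_{|z-\lambda|=\delta}\|(\mathrm{id}-\mathcal K(z))^{-1}\|_0\,N^{p-k}=o(1),$$ $$\delta\max_{|z-\lambda|=\delta}\|(\mathrm{id}-\mathcal K(z))^{-1}\|_0\max_{|z-\lambda|=\delta}\|(\mathrm{id}-\mathcal K(z))^{-1}\|_t\,N^{-t}(|\lambda|+1)^{\lceil t/(k-p)\rceil}=o(1).$$ Then there exists $N_0=N_0(\delta,\lambda)$ such that for all $N>N_0$ there is an eigenvalue $\lambda_N$ of $\mathcal L_0+\mathcal P_N\mathcal L_1$ with $|\lambda-\lambda_N|\le\delta$.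
   Context: $\mathbb T=[0,2\pi)$ with endpoints identified, $e_j(\theta)=e^{ij\theta}$, $u_j=\frac1{2\pi}\int_0^{2\pi}u\,\overline{e_j}\,d\theta$. For $s\in\mathbb R$, $H^s(\mathbb T)$ has norm $\|u\|_s^2=c_{|s|}\sum_j|u_j|^2\max\{1,|j|\}^{2s}$ (bi-infinite sequences when $s<0$), with fixed normalization constants $c_{|s|}>0$; operator norms on $H^s$ are also written $\|\cdot\|_s$. For $N\ge1$, $N_-=\lfloor N/2\rfloor$, $N_+=\lfloor(N-1)/2\rfloor$, $\mathcal P_Nu=\sum_{j=-N_-}^{N_+}u_je_j$. Fix integers $k\ge1$, $0\le p<k$, $0\le q\le k$, $\ell\ge1$, constants $c_q,\dots,c_k\in\mathbb C$ with $c_k\ne0$, $a_0,\dots,a_p\in H^\ell(\mathbb T)$; $\mathcal L_0u=\sum_{j=q}^kc_j\frac{d^ju}{d\theta^j}$, $\mathcal L_1u=\sum_{j=0}^pa_j\frac{d^ju}{d\theta^j}$, $\mathcal L=\mathcal L_0+\mathcal L_1$. Fix $\zeta\in\mathbb C$ with $\zeta\ne\sum_{j=q}^kc_j(im)^j$ for all $m\in\mathbb Z$, and $\mathcal N=(\mathcal L_0-\zeta\,\mathrm{id})^{-1}$. For Hilbert spaces $\mathbb V\subset\mathbb W$ (continuous inclusion) and bounded $\mathcal L:\mathbb V\to\mathbb W$, the $\epsilon$-pseudospectrum is $\sigma_\epsilon(\mathcal L;\mathbb V,\mathbb W)=\overline{\{z\in\mathbb C:\|(z\,\mathrm{id}-\mathcal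 L)^{-1}\|_{\mathbb W\to\mathbb V}>\epsilon^{-1}\}}$, with the convention that the norm is $\infty$ when $z\,\mathrm{id}-\mathcal L:\mathbb V\to\mathbb W$ has no bounded inverse; $\rho_\epsilon(\mathcal L;\mathbb V,\mathbb W)$ is its complement in $\mathbb C$. *)

(* Defs.v *)
From HB Require Import structures.
From mathcomp Require Import all_boot all_order all_algebra.
From mathcomp Require Import all_classical all_reals all_analysis.
From mathcomp Require Import complex.
Set Implicit Arguments. Unset Strict Implicit. Unset Printing Implicit Defensive.
Import Order.TTheory GRing.Theory Num.Theory.
Import numFieldNormedType.Exports.
Local Open Scope classical_set_scope.
Local Open Scope ring_scope.
Local Open Scope complex_scope.

Section Defs.
Variable R : realType.

(* Sequences of Fourier coefficients  u = (u_j)_{j in Z}. *)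
Definition seqZ := int -> R[i].

Definition cabs (z : R[i]) : R := Num.sqrt (complex.Re z ^+ 2 + complex.Im z ^+ 2).

Definition wt (s : R) (j : int) : R := (Num.max 1 (`|j|%:~R : R)) `^ (2 * s).

Definition snorm2 (cst : R -> R) (s : R) (u : seqZ) : \bar R :=
  ((cst `|s|)%:E * \esum_(j in [set: int]) ((cabs (u j)) ^+ 2 * wt s j)%:E)%E.

Definition inH (s : R) (u : seqZ) : Prop :=
  (\esum_(j in [set: int]) ((cabs (u j)) ^+ 2 * wt s j)%:E < +oo)%E.

Definition psum (f : int -> R[i]) (n : nat) : R[i] :=
  \sum_(0 <= i < (2 * n).+1) f (i%:Z - n%:Z).
Definition cser (f : int -> R[i]) : R[i] :=
  (limn (fun n => complex.Re (psum f n))) +i* (limn (fun n => complex.Im (psum f n))).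

(* Fourier coefficients of a product a*u: (a u)_m = sum_j a_{m-j} u_j *)
Definition mulZ (a u : seqZ) : seqZ := fun m => cser (fun j => a (m - j) * u j).

Definition derivZ (d : nat) (u : seqZ) : seqZ := fun j => ('i * j%:~R) ^+ d * u j.

Definition symb (c : nat -> R[i]) (q k : nat) (m : int) : R[i] :=
  \sum_(q <= d < k.+1) c d * ('i * m%:~R) ^+ d.

Definition L0op (c : nat -> R[i]) (q k : nat) (u : seqZ) : seqZ :=
  fun j => symb c q k j * u j.
Definition L1op (a : nat -> seqZ) (p : nat) (u : seqZ) : seqZ :=
  fun m => \sum_(0 <= d < p.+1) mulZ (a d) (derivZ d u) m.
Definition Lop c q k a p (u : seqZ) : seqZ :=
  fun j => L0op c q k u j + L1op a p u j.

(* N = (L0 - zeta id)^{-1} *)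
Definition Nop (c : nat -> R[i]) (q k : nat) (zeta : R[i]) (v : seqZ) : seqZ :=
  fun j => v j / (symb c q k j - zeta).

Definition inPN (N : nat) (j : int) : bool :=
  (- (N./2)%:Z <= j) && (j <= ((N.-1)./2)%:Z).
Definition PN (N : nat) (u : seqZ) : seqZ := fun j => if inPN N j then u j else 0.

(* norm of the inverse of T : H^a -> H^b (as a map H^b -> H^a);
   +oo when T has no bounded inverse *)
Definition inv_norm (cst : R -> R) (a b : R) (T : seqZ -> seqZ) : \bar R :=
  ereal_inf [set M%:E | M in [set M : R | 0 <= M /\
     exists G : seqZ -> seqZ,
       (forall u, inH a u -> inH b (T u) /\ G (T u) = u) /\
       (forall v, inH b v -> inH a (G v) /\ T (G v) = v) /\
       (forall v, inH b v -> (snorm2 cst a (G v) <= (M ^+ 2)%:E * snorm2 cst b v)%E)]].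

Definition zminusL c q k a p (z : R[i]) (u : seqZ) : seqZ :=
  fun j => z * u j - Lop c q k a p u j.

Definition in_closureC (A : set R[i]) (z : R[i]) : Prop :=
  forall e : R, 0 < e -> exists w, A w /\ cabs (z - w) < e.

Definition pseudospec cst c q k a p (s eps : R) : set R[i] :=
  in_closureC [set z | (inv_norm cst s (s - k%:R) (zminusL c q k a p z) > (eps^-1)%:E)%E].

Definition fin_eig c q k a p (N : nat) (lam : R[i]) : Prop :=
  exists u : seqZ, (forall j, ~~ inPN N j -> u j = 0) /\ (exists j, u j != 0) /\
    forall j, L0op c q k u j + PN N (L1op a p u) j = lam * u j.

Definition isolated_eig cst c q k a p (lam : R[i]) : Prop :=
  (exists u : seqZ, inH k%:R u /\ (exists j, u j != 0) /\
     forall j, Lop c q k a p u j = lam * u j) /\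
  exists r : R, 0 < r /\ forall z, 0 < cabs (z - lam) < r ->
     (inv_norm cst k%:R 0 (zminusL c q k a p z) < +oo)%E.

Definition idK c q k a p zeta (z : R[i]) (u : seqZ) : seqZ :=
  Nop c q k zeta (fun j => Lop c q k a p u j - z * u j).

Definition maxK cst c q k a p zeta (lam : R[i]) (delta t : R) : \bar R :=
  ereal_sup [set inv_norm cst t t (idK c q k a p zeta z) | z in [set z | cabs (z - lam) = delta]].

(* f(N) = o(1) as N -> oo, for nonnegative extended-real valued f *)
Definition small_o1 (f : nat -> \bar R) : Prop :=
  forall e : R, 0 < e -> exists N1, forall N, (N1 <= N)%N -> (f N <= e%:E)%E.

End Defs.

(* Main.v *)
Require Import Defs.
From HB Require Import structures.
From mathcomp Require Import all_boot all_order all_algebra.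
From mathcomp Require Import all_classical all_reals all_analysis.
From mathcomp Require Import complex.
From mathcomp Require Import ring lra zify.
Set Implicit Arguments. Unset Strict Implicit. Unset Printing Implicit Defensive.
Import Order.TTheory GRing.Theory Num.Theory.
Import numFieldNormedType.Exports.
Local Open Scope classical_set_scope.
Local Open Scope ring_scope.
Local Open Scope complex_scope.

(* (1) Let u be an eigenvector of L0 + PN L1 with eigenvalue lam. Then (lam - L) u =
   - (1 - PN) L1 u lives on frequencies at least N/2, and since L1 loses only p < k
   derivatives its H^(s-k) norm is O(N^(p-k)) times the H^s norm of u, provided that
   L1 : H^(p+rho) -> H^rho is bounded for some rho >= max (s-k, s-p). When s > p + l no such
   rho is available. If the coefficients are not in H^(s-k), then L does not even map H^s to
   H^(s-k) and the pseudospectrum is everything; otherwise take rho = max (l, s-k). If lam is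
   small compared to N^k, replace u by u + v with v = (lam - L0)^-1 (1 - PN) L1 u, whose
   residual - L1 v is O(N^(p-k)); if lam is comparable to N^k, the eigenvalue equation makes
   the low frequencies of u negligible and u itself still works.

   (2) Let u be an eigenfunction of L and A the matrix of L0 + PN L1 on ran PN. Then
   (lam - A) PN u = g := PN L1 (1 - PN) u, which is O(N^(p-k)). On the circle
   |z - lam| = delta the hypothesis on id - K(z) survives the truncation and gives
   |(z - A)^-1 g| = o(1). If A had no eigenvalue in the disc, the maximum principle for the
   rational function (z - A)^-1 g would give |PN u| = o(1), which is absurd. *)

(** * The real-valued modulus of a complex number *)

Section Modulus.
Variable R : realType.
Implicit Types x y z : R[i].

Lemma normcE z : `|z| = (cabs z)%:C.
Proof. by case: z. Qed.

Lemma cabs_ge0 z : 0 <= cabs z.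
Proof. exact: sqrtr_ge0. Qed.

Lemma cabsM x y : cabs (x * y) = cabs x * cabs y.
Proof. by apply: complexI; rewrite rmorphM /= -!normcE normrM. Qed.

Lemma cabs1 : cabs (1 : R[i]) = 1.
Proof. by apply: complexI; rewrite -normcE normr1. Qed.

Lemma cabs0 : cabs (0 : R[i]) = 0.
Proof. by apply: complexI; rewrite -normcE normr0. Qed.

Lemma cabsX x n : cabs (x ^+ n) = cabs x ^+ n.
Proof. by elim: n => [|n IH]; rewrite ?expr0 ?cabs1 // !exprS cabsM IH. Qed.

Lemma cabsN x : cabs (- x) = cabs x.
Proof. by apply: complexI; rewrite -!normcE normrN. Qed.

Lemma cabs_eq0 x : (cabs x == 0) = (x == 0).
Proof. by rewrite -(inj_eq (@complexI R)) -normcE normr_eq0. Qed.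

Lemma cabs_gt0 x : (0 < cabs x) = (x != 0).
Proof. by rewrite lt_neqAle cabs_ge0 andbT eq_sym cabs_eq0. Qed.

Lemma cabsV x : cabs x^-1 = (cabs x)^-1.
Proof.
have [->|x0] := eqVneq x 0; first by rewrite invr0 cabs0 invr0.
have cx0 : cabs x != 0 by rewrite cabs_eq0.
by apply: (mulfI cx0); rewrite -cabsM !mulfV // cabs1.
Qed.

Lemma ler_cabsD x y : cabs (x + y) <= cabs x + cabs y.
Proof. by rewrite -lecR rmorphD /= -!normcE ler_normD. Qed.

Lemma cabs_distC x y : cabs (x - y) = cabs (y - x).
Proof. by rewrite -cabsN opprB. Qed.

Lemma ler_cabsB x y : cabs x - cabs y <= cabs (x - y).
Proof. by rewrite lerBlDr -{1}(subrK y x) ler_cabsD. Qed.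

Lemma cabs_sqE z : cabs z ^+ 2 = complex.Re z ^+ 2 + complex.Im z ^+ 2.
Proof. by rewrite sqr_sqrtr // addr_ge0 // sqr_ge0. Qed.

Lemma cabs_real (r : R) : cabs r%:C = `|r|.
Proof. by rewrite /cabs /= expr0n addr0 sqrtr_sqr. Qed.

Lemma cabs_int (m : int) : cabs (m%:~R : R[i]) = `|m%:~R|.
Proof. by rewrite -cabs_real rmorph_int. Qed.

Lemma cabs_i : cabs ('i : R[i]) = 1.
Proof. by rewrite /cabs /= expr0n /= add0r expr1n sqrtr1. Qed.

Lemma sqrD_le2 (x y : R) : (x + y) ^+ 2 <= 2 * x ^+ 2 + 2 * y ^+ 2.
Proof. by have := sqr_ge0 (x - y); rewrite !expr2; nra. Qed.

Lemma cabs_sqD x y : cabs (x + y) ^+ 2 <= 2 * cabs x ^+ 2 + 2 * cabs y ^+ 2.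
Proof.
apply: le_trans (sqrD_le2 _ _).
by rewrite lerXn2r ?nnegrE ?addr_ge0 ?cabs_ge0 ?ler_cabsD.
Qed.

Lemma cabs_sum (I : Type) (s : seq I) (F : I -> R[i]) :
  cabs (\sum_(i <- s) F i) <= \sum_(i <- s) cabs (F i).
Proof.
elim: s => [|i s IH]; rewrite ?big_nil ?cabs0 // !big_cons.
exact: le_trans (ler_cabsD _ _) (lerD _ IH).
Qed.

Lemma Re_cabs z : `|complex.Re z| <= cabs z.
Proof. by rewrite -lecR -normcE; case: z => a b; exact: normc_ge_Re. Qed.

Lemma Im_cabs z : `|complex.Im z| <= cabs z.
Proof.
by rewrite -[X in X <= _]sqrtr_sqr ler_wsqrtr // lerDr sqr_ge0.
Qed.

End Modulus.

(** * Sums over the integers through their finite partial sums *)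

Section BoundedSums.
Variable R : realType.
Implicit Types (F G : int -> R) (A B : R) (s t : seq int).

(* [bsum F A] bounds every finite partial sum, which for F >= 0 says that
   F is summable over Z with sum at most A. *)
Definition bsum F A := forall s, uniq s -> \sum_(j <- s) F j <= A.

Lemma bsum_ge0 F A : bsum F A -> 0 <= A.
Proof. by move=> /(_ [::] isT); rewrite big_nil. Qed.

Lemma bsum_point F A j : bsum F A -> F j <= A.
Proof. by move=> /(_ [:: j] isT); rewrite big_seq1. Qed.

Lemma bsum_le F G A B : (forall j, F j <= G j) -> A <= B -> bsum G A -> bsum F B.
Proof.
by move=> FG AB GA s us; apply: le_trans AB; apply: le_trans (GA s us); apply: ler_sum.
Qed.

Lemma bsumD F G A B : bsum F A -> bsum G B -> bsum (fun j => F j + G j) (A + B).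
Proof. by move=> FA GB s us; rewrite big_split lerD ?FA ?GB. Qed.

Lemma bsumZ F A c : 0 <= c -> bsum F A -> bsum (fun j => c * F j) (c * A).
Proof. by move=> c0 FA s us; rewrite -mulr_sumr ler_wpM2l ?FA. Qed.

Lemma bsum_inj F A (f : int -> int) : injective f -> bsum F A -> bsum (F \o f) A.
Proof. by move=> fi FA s us; rewrite -(big_map f xpredT F) FA // map_inj_uniq. Qed.

Lemma bsum_shift F A m : bsum F A -> bsum (fun j => F (j + m)) A.
Proof. by apply: bsum_inj; exact: addIr. Qed.

Lemma bsum_reflect F A m : bsum F A -> bsum (fun j => F (m - j)) A.
Proof. by apply: (@bsum_inj F A (fun j => m - j)) => i j /addrI /oppr_inj. Qed.

Lemma ler_sum_sub F s t : (forall j, 0 <= F j) -> uniq s -> uniq t ->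
  {subset s <= t} -> \sum_(j <- s) F j <= \sum_(j <- t) F j.
Proof.
move=> F0 us ut st.
rewrite [leRHS](bigID (mem s)) /=.
rewrite [X in _ <= X + _](_ : _ = \sum_(j <- s) F j); last first.
  rewrite -big_filter; apply: perm_big; apply: uniq_perm => //.
    exact: filter_uniq.
  by move=> j; rewrite mem_filter andb_idr //; exact: st.
by rewrite lerDl sumr_ge0.
Qed.

Lemma esum_le_bsum F A : (forall j, 0 <= F j) ->
  (\esum_(j in [set: int]) (F j)%:E <= A%:E)%E <-> bsum F A.
Proof.
move=> F0; split => [H s us|H].
- rewrite -lee_fin; apply: le_trans H.
  apply: ereal_sup_ubound; exists [set` s].
    by split => //; exact: finite_seq.
  by rewrite -fsbig_seq // sumEFin.
- apply: ub_ereal_sup => _ [X [fX _] <-].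
  rewrite fsbig_finite //= sumEFin lee_fin; apply: H.
  exact: finmap.fset_uniq.
Qed.

(** Weighted Cauchy-Schwarz, by induction on the list; this form tolerates vanishing weights, so no
    division occurs. *)
Lemma sum_cauchy (I : Type) (w x : I -> R) (s : seq I) : (forall j, 0 <= w j) ->
  (\sum_(j <- s) w j * x j) ^+ 2 <=
  (\sum_(j <- s) w j) * (\sum_(j <- s) w j * x j ^+ 2).
Proof.
move=> w0; elim: s => [|j s IH]; first by rewrite !big_nil expr0n mulr0.
rewrite !big_cons; move: IH.
have W0 : 0 <= \sum_(j <- s) w j by apply: sumr_ge0.
have Q0 : 0 <= \sum_(j <- s) w j * x j ^+ 2.
  by apply: sumr_ge0 => i _; rewrite mulr_ge0 // sqr_ge0.
move: (\sum_(j <- s) w j * x j) W0 Q0 => S.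
move: (\sum_(j <- s) w j) (\sum_(j <- s) w j * x j ^+ 2) => W Q W0 Q0 SWQ.
move: (w j) (w0 j) (x j) => a a0 b.
(* Expanding both sides, the new terms contribute [a] times this quadratic in [b]; its discriminant
   is nonpositive because S^2 <= W Q by induction. *)
suff H : 0 <= W * b ^+ 2 - 2 * S * b + Q.
  by have := mulr_ge0 a0 H; rewrite !expr2 in SWQ *; nra.
move: W0; rewrite le_eqVlt => /predU1P[W0|W0].
  move: SWQ; rewrite -W0 mul0r => SS.
  have /eqP := le_anti (introT andP (conj SS (sqr_ge0 S))).
  by rewrite sqrf_eq0 => /eqP ->; rewrite mulr0 !mul0r subr0 add0r.
rewrite -(pmulr_rge0 _ W0).
have := sqr_ge0 (W * b - S); rewrite !expr2 in SWQ *; nra.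
Qed.

End BoundedSums.

(** * The bracket max(1,|j|), Sobolev weights and symmetric ranges of integers *)

Section Weights.
Variable R : realType.
Implicit Types (s t x : R) (j m : int).

Definition jb j : R := Num.max 1 (`|j|%:~R).

Lemma jb_ge1 j : 1 <= jb j.
Proof. by rewrite le_max lexx. Qed.

Lemma jb_gt0 j : 0 < jb j.
Proof. exact: lt_le_trans ltr01 (jb_ge1 j). Qed.

Lemma jb_ge0 j : 0 <= jb j.
Proof. exact: ltW (jb_gt0 j). Qed.

Lemma jb_neq0 j : jb j != 0.
Proof. by rewrite gt_eqF ?jb_gt0. Qed.

Lemma jb_norm j : `|j%:~R| <= jb j.
Proof. by rewrite -intr_norm le_max lexx orbT. Qed.

Lemma jb_le (n : nat) j : (0 < n)%N -> (`|j|%N <= n)%N -> jb j <= n%:R.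
Proof.
by move=> n0 jn; rewrite ge_max ler1n n0 /= -abszE -pmulrn ler_nat.
Qed.

Lemma jb_ge (n : nat) j : (n <= `|j|%N)%N -> n%:R <= jb j.
Proof. by move=> nj; rewrite le_max -abszE -pmulrn ler_nat nj orbT. Qed.

Lemma jb_addl i j : jb (i + j) <= jb i + jb j.
Proof.
rewrite ge_max; apply/andP; split.
  by rewrite (le_trans (jb_ge1 i)) // lerDl jb_ge0.
rewrite intr_norm rmorphD /=.
exact: le_trans (ler_normD _ _) (lerD (jb_norm _) (jb_norm _)).
Qed.

Lemma wtE s j : wt s j = (jb j `^ s) ^+ 2.
Proof.
by rewrite /wt -/(jb j) mulr_natl mulr2n powRD ?jb_neq0 ?implybT // expr2.
Qed.

Lemma wt_gt0 s j : 0 < wt s j.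
Proof. by rewrite /wt powR_gt0 // jb_gt0. Qed.

Lemma wt_ge0 s j : 0 <= wt s j.
Proof. exact: ltW (wt_gt0 s j). Qed.

Lemma wtD s t j : wt (s + t) j = wt s j * wt t j.
Proof. by rewrite /wt mulrDr powRD // jb_neq0 implybT. Qed.

Lemma wt0 j : wt 0 j = 1 :> R.
Proof. by rewrite /wt mulr0 powRr0. Qed.

Lemma wt_nat (n : nat) j : wt n%:R j = (jb j ^+ n) ^+ 2.
Proof. by rewrite wtE powR_mulrn ?jb_ge0. Qed.

Lemma wtN s j : wt (- s) j = (wt s j)^-1.
Proof. by rewrite /wt mulrN powRN. Qed.

Lemma wt_mono s t j : s <= t -> wt s j <= wt t j.
Proof. by move=> st; apply: ler_powR; rewrite ?jb_ge1 // ler_pM2l. Qed.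

Lemma wt_head s x j : jb j <= x -> 0 <= s -> wt s j <= x `^ (2 * s).
Proof.
move=> jx s0; have s2 : 0 <= 2 * s by rewrite mulr_ge0.
have x0 := le_trans (jb_ge0 j) jx.
by apply: ge0_ler_powR => //; rewrite nnegrE ?jb_ge0.
Qed.

Lemma wt_tail s x j : 0 < x -> x <= jb j -> s <= 0 -> wt s j <= x `^ (2 * s).
Proof.
move=> x0 xj s0; rewrite -(opprK s) wtN mulrN powRN lef_pV2 ?posrE ?wt_gt0 ?powR_gt0 //.
have s2 : 0 <= 2 * - s by rewrite mulr_ge0 ?oppr_ge0.
by apply: ge0_ler_powR => //; rewrite nnegrE ?jb_ge0 ?ltW.
Qed.

(** The bracket of [i + j] is at most twice the larger of the two brackets. This distributes a
    Sobolev weight over the two factors of a convolution. *)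
Lemma wt_sub s i j : 0 <= s ->
  jb (i + j) `^ s <= 2 `^ s * (jb i `^ s + jb j `^ s).
Proof.
move=> s0.
have [ij|/ltW ij] := lerP (jb i) (jb j).
  apply: (@le_trans _ _ ((2 * jb j) `^ s)).
    apply: ge0_ler_powR; rewrite ?nnegrE ?mulr_ge0 ?jb_ge0 //.
    by rewrite (le_trans (jb_addl _ _)) // mulr_natl mulr2n lerD2r.
  by rewrite powRM ?jb_ge0 // ler_wpM2l ?powR_ge0 // lerDr powR_ge0.
apply: (@le_trans _ _ ((2 * jb i) `^ s)).
  apply: ge0_ler_powR; rewrite ?nnegrE ?mulr_ge0 ?jb_ge0 //.
  by rewrite (le_trans (jb_addl _ _)) // mulr_natl mulr2n lerD2l.
by rewrite powRM ?jb_ge0 // ler_wpM2l ?powR_ge0 // lerDl powR_ge0.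
Qed.

(** The index range -n, ..., n of [psum]; locked so that simplification does not unfold it. *)
Definition zs (n : nat) : seq int :=
  locked [seq i%:Z - n%:Z | i <- iota 0 (2 * n).+1].

Lemma zs_uniq n : uniq (zs n).
Proof. by rewrite /zs -lock map_inj_uniq ?iota_uniq // => i j; lia. Qed.

Lemma mem_zs n j : (j \in zs n) = (`|j|%N <= n)%N.
Proof.
rewrite /zs -lock; apply/mapP/idP => [[h]|jn].
  by rewrite mem_iota => ? ->; lia.
exists (absz (j + n%:Z)); last by lia.
by rewrite mem_iota; lia.
Qed.

Lemma zsS (F : int -> R) n :
  \sum_(j <- zs n.+1) F j = F n.+1%:Z + (F (- n.+1%:Z) + \sum_(j <- zs n) F j).
Proof.
rewrite (perm_big [:: n.+1%:Z, - n.+1%:Z & zs n]) ?big_cons //.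
apply: uniq_perm => [||j]; first exact: zs_uniq.
  by rewrite 2!cons_uniq zs_uniq !inE !mem_zs; lia.
by rewrite !inE !mem_zs; lia.
Qed.

Lemma sub_zs (s : seq int) : exists n, {subset s <= zs n}.
Proof.
elim: s => [|j s [n sn]]; first by exists 0%N.
exists (maxn n `|j|%N) => i; rewrite inE mem_zs => /predU1P[->|/sn].
  by rewrite leq_maxr.
by rewrite mem_zs => /leq_trans -> //; rewrite leq_maxl.
Qed.

Lemma bsum_wtN1 : bsum (@wt R (-1)) 5.
Proof.
(* The sharper bound with - 2 / (n+1) makes the induction close: it is the telescoping estimate
   1/(x+1)^2 <= 1/x - 1/(x+1), taken twice for the frequencies of both signs. *)
have key n : \sum_(j <- zs n.+1) @wt R (-1) j <= 5 - 2 / n.+1%:R.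
  have wE (i : nat) (j : int) : `|j|%N = i.+1 -> @wt R (-1) j = (i.+1%:R ^+ 2)^-1.
    move=> ji; rewrite wtN (_ : 1 = 1%:R) // wt_nat expr1; congr ((_ ^+ 2)^-1).
    by apply/le_anti; rewrite jb_le ?ji // jb_ge ?ji.
  elim: n => [|n IH].
    rewrite zsS (wE 0%N) // (wE 0%N) // /zs -lock /= big_seq1.
    by rewrite wtN (_ : 1 = 1%:R) // wt_nat expr1 /jb /= subr0 normr0 max_l ?ler01 //;
       rewrite expr1n invr1; lra.
  rewrite zsS (wE n.+1) // (wE n.+1) ?abszN //.
  rewrite -[leRHS](subrK (5 - 2 / n.+1%:R)) addrA lerD //.
  have n0 : 0 < n.+1%:R :> R by [].
  rewrite (_ : n.+2%:R = n.+1%:R + 1 :> R); last by rewrite -natr1.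
  move: (n.+1%:R : R) n0 => x x0.
  have -> : 5 - 2 / (x + 1) - (5 - 2 / x) = 2 / (x * (x + 1)).
    by field; rewrite !gt_eqF //; lra.
  have : ((x + 1) ^+ 2)^-1 <= (x * (x + 1))^-1.
    by rewrite lef_pV2 ?posrE ?exprn_gt0 ?mulr_gt0 //; nra.
  lra.
move=> s us; have [n sn] := sub_zs s.
apply: (@le_trans _ _ (\sum_(j <- zs n.+1) @wt R (-1) j)).
  apply: ler_sum_sub us (zs_uniq _) _ => [j|j /sn]; first exact: wt_ge0.
  by rewrite !mem_zs => /leqW.
by apply: le_trans (key n) _; rewrite gerBl divr_ge0.
Qed.

End Weights.
Arguments jb {R} j.

(** * Squared Sobolev norms without the normalization constants *)

Section Sobolev.
Variable R : realType.
Implicit Types (s t : R) (u v : seqZ R).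

(** An upper bound [B] for the squared H^s norm. It asserts membership in H^s and the estimate at
    once, so that norm inequalities become termwise comparisons. *)
Definition N2 s u B := bsum (fun j => cabs (u j) ^+ 2 * wt s j) B.

(** Meaningful when [inH s u] holds; for an infinite sum [fine] returns 0. *)
Definition nrm2 s u : R :=
  fine (\esum_(j in [set: int]) (cabs (u j) ^+ 2 * wt s j)%:E).

Lemma en_ge0 s u j : 0 <= cabs (u j) ^+ 2 * wt s j.
Proof. by rewrite mulr_ge0 ?sqr_ge0 ?wt_ge0. Qed.
Hint Resolve en_ge0 : core.

Lemma inH_fin s u : inH s u ->
  (\esum_(j in [set: int]) (cabs (u j) ^+ 2 * wt s j)%:E)%E = (nrm2 s u)%:E.
Proof.
move=> Hu; rewrite /nrm2 fineK // ge0_fin_numE //.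
by apply: esum_ge0 => j _; rewrite lee_fin.
Qed.

Lemma inHP s u : inH s u <-> exists B, N2 s u B.
Proof.
split => [Hu|[B /esum_le_bsum H]].
  exists (nrm2 s u); have [+ _] := esum_le_bsum (nrm2 s u) (en_ge0 s u).
  by apply; rewrite inH_fin.
by apply: le_lt_trans (H _) (ltry _).
Qed.

Lemma N2_inH s u B : N2 s u B -> inH s u.
Proof. by move=> H; apply/inHP; exists B. Qed.

Lemma nrm2P s u : inH s u -> N2 s u (nrm2 s u).
Proof.
move=> Hu; have [+ _] := esum_le_bsum (nrm2 s u) (en_ge0 s u).
by apply; rewrite inH_fin.
Qed.

Lemma nrm2_le s u B : N2 s u B -> nrm2 s u <= B.
Proof.
move=> H; rewrite -lee_fin -inH_fin; last exact: N2_inH H.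
by have [_ +] := esum_le_bsum B (en_ge0 s u); apply.
Qed.

Lemma nrm2_ge0 s u : 0 <= nrm2 s u.
Proof. by apply: fine_ge0; apply: esum_ge0 => j _; rewrite lee_fin. Qed.

Lemma nrm2_point s u j : inH s u -> cabs (u j) ^+ 2 * wt s j <= nrm2 s u.
Proof. by move=> Hu; exact: (bsum_point j (nrm2P Hu)). Qed.

Lemma nrm2_gt0 s u j : inH s u -> u j != 0 -> 0 < nrm2 s u.
Proof.
move=> Hu uj; apply: lt_le_trans (nrm2_point j Hu).
by rewrite mulr_gt0 ?wt_gt0 // exprn_gt0 // cabs_gt0.
Qed.

Lemma snorm2E cst s u : inH s u -> snorm2 cst s u = (cst `|s| * nrm2 s u)%:E.
Proof. by move=> Hu; rewrite /snorm2 inH_fin. Qed.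

Lemma N2_le s u A B : A <= B -> N2 s u A -> N2 s u B.
Proof. by move=> AB; apply: bsum_le. Qed.

Lemma N2_dom s t u v C B : 0 <= C ->
  (forall j, cabs (v j) ^+ 2 * wt t j <= C * (cabs (u j) ^+ 2 * wt s j)) ->
  N2 s u B -> N2 t v (C * B).
Proof. by move=> C0 H Hu; apply: bsum_le H (lexx _) (bsumZ C0 Hu). Qed.

Lemma N2_mono s t u B : s <= t -> N2 t u B -> N2 s u B.
Proof. by move=> st; apply: bsum_le => // j; rewrite ler_wpM2l ?sqr_ge0 ?wt_mono. Qed.

Lemma inH_mono s t u : s <= t -> inH t u -> inH s u.
Proof. by move=> st /inHP[B Hu]; exact: N2_inH (N2_mono st Hu). Qed.

Lemma N2D s u v A B : N2 s u A -> N2 s v B ->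
  N2 s (fun j => u j + v j) (2 * A + 2 * B).
Proof.
move=> Hu Hv; apply: bsum_le (lexx _) (bsumD (bsumZ (ler0n _ 2) Hu) (bsumZ (ler0n _ 2) Hv)).
move=> j; have := ler_wpM2r (wt_ge0 s j) (cabs_sqD (u j) (v j)).
by rewrite mulrDl -!mulrA.
Qed.

Lemma N2_0 s : N2 s (fun=> 0) 0.
Proof. by move=> S _; rewrite big1 // => j _; rewrite cabs0 expr0n mul0r. Qed.

Lemma inHD s u v : inH s u -> inH s v -> inH s (fun j => u j + v j).
Proof. by move=> /inHP[A Hu] /inHP[B Hv]; exact: N2_inH (N2D Hu Hv). Qed.

Lemma inHZ s c u : inH s u -> inH s (fun j => c * u j).
Proof.
move=> /inHP[A Hu].
have H : N2 s (fun j => c * u j) (cabs c ^+ 2 * A).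
  by apply: N2_dom (sqr_ge0 _) _ Hu => j; rewrite cabsM exprMn -mulrA.
exact: N2_inH H.
Qed.

Lemma inH_finite s u (S : seq int) : (forall j, j \notin S -> u j = 0) -> inH s u.
Proof.
move=> uS; apply/inHP; exists (\sum_(j <- undup S) cabs (u j) ^+ 2 * wt s j) => t ut.
rewrite (bigID (mem S)) /= [X in _ + X]big1 ?addr0; last first.
  by move=> j /uS ->; rewrite cabs0 expr0n mul0r.
rewrite -big_filter; apply: ler_sum_sub; rewrite ?filter_uniq ?undup_uniq //.
by move=> j; rewrite mem_filter mem_undup => /andP[].
Qed.

End Sobolev.
#[global] Hint Resolve en_ge0 : core.

(** * Convergence of series of complex numbers over the integers *)

Section BilateralSeries.
Variable R : realType.
Implicit Types (f g : int -> R[i]).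

Lemma psumE f n : psum f n = \sum_(j <- zs n) f j.
Proof. by rewrite /psum /zs -lock big_map /index_iota subn0. Qed.

Lemma Re_sum (S : seq int) f : complex.Re (\sum_(j <- S) f j) = \sum_(j <- S) complex.Re (f j).
Proof. by apply: big_morph => //; case=> ? ? []. Qed.

Lemma Im_sum (S : seq int) f : complex.Im (\sum_(j <- S) f j) = \sum_(j <- S) complex.Im (f j).
Proof. by apply: big_morph => //; case=> ? ? []. Qed.

(** Write g as (|g| + g) - |g|: both parts are nonnegative, so their symmetric partial sums are
    monotone and bounded. *)
Lemma zs_sum_cvg (g : int -> R) B : bsum (fun j => `|g j|) B ->
  cvgn (fun n => \sum_(j <- zs n) g j).
Proof.
move=> gB.
have mono h C : (forall j, 0 <= h j) -> bsum h C -> cvgn (fun n => \sum_(j <- zs n) h j : R).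
  move=> h0 hC; apply: nondecreasing_is_cvgn.
    move=> m n mn; apply: ler_sum_sub (zs_uniq _) (zs_uniq _) _ => // j.
    by rewrite !mem_zs => /leq_trans; apply.
  by exists C => _ [n _ <-]; exact: hC (zs_uniq n).
have -> : (fun n => \sum_(j <- zs n) g j) =
    (fun n => \sum_(j <- zs n) (`|g j| + g j)) \- (fun n => \sum_(j <- zs n) `|g j|).
  by apply/funext => n /=; rewrite -sumrB; apply: eq_bigr => j _; rewrite addrAC subrr add0r.
apply: is_cvgB; last exact: mono gB.
apply: (@mono _ (B + B)) => [j|]; first by have := ler_norm (- g j); rewrite normrN; lra.
apply: bsum_le (lexx _) (bsumD gB gB) => j /=.
by rewrite lerD2l ler_norm.
Qed.

Section Summable.
Variables (f : int -> R[i]) (B : R).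
Hypothesis fB : bsum (fun j => cabs (f j)) B.

Lemma Re_cser : (fun n => complex.Re (psum f n)) @ \oo --> complex.Re (cser f).
Proof.
rewrite /cser /=; under eq_fun do rewrite psumE Re_sum.
by apply: (@zs_sum_cvg _ B); apply: bsum_le (lexx _) fB => j; exact: Re_cabs.
Qed.

Lemma Im_cser : (fun n => complex.Im (psum f n)) @ \oo --> complex.Im (cser f).
Proof.
rewrite /cser /=; under eq_fun do rewrite psumE Im_sum.
by apply: (@zs_sum_cvg _ B); apply: bsum_le (lexx _) fB => j; exact: Im_cabs.
Qed.

End Summable.

Lemma cserD f g A B : bsum (fun j => cabs (f j)) A -> bsum (fun j => cabs (g j)) B ->
  cser (fun j => f j + g j) = cser f + cser g.
Proof.
move=> fA gB; apply/eqP; rewrite eq_complex; apply/andP; split; apply/eqP.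
- rewrite [RHS](_ : _ = complex.Re (cser f) + complex.Re (cser g)); last first.
    by case: (cser f) (cser g) => ? ? [].
  rewrite {1}/cser /=; apply: cvg_lim => //.
  have E n : complex.Re (psum (fun j => f j + g j) n) =
      complex.Re (psum f n) + complex.Re (psum g n).
    by rewrite !psumE big_split /=; case: (\sum_(j <- _) f j) (\sum_(j <- _) g j) => ? ? [].
  rewrite (funext E).
  by apply: cvgD; [exact: Re_cser fA|exact: Re_cser gB].
- rewrite [RHS](_ : _ = complex.Im (cser f) + complex.Im (cser g)); last first.
    by case: (cser f) (cser g) => ? ? [].
  rewrite {1}/cser /=; apply: cvg_lim => //.
  have E n : complex.Im (psum (fun j => f j + g j) n) =
      complex.Im (psum f n) + complex.Im (psum g n).
    by rewrite !psumE big_split /=; case: (\sum_(j <- _) f j) (\sum_(j <- _) g j) => ? ? [].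
  rewrite (funext E).
  by apply: cvgD; [exact: Im_cser fA|exact: Im_cser gB].
Qed.

Lemma cser_finite f (S : seq int) : uniq S -> (forall j, j \notin S -> f j = 0) ->
  cser f = \sum_(j <- S) f j.
Proof.
move=> uS fS.
have [n0 Sn0] := sub_zs S.
have E n : (n0 <= n)%N -> psum f n = \sum_(j <- S) f j.
  move=> n0n; rewrite psumE (bigID (mem S)) /= [X in _ + X]big1 ?addr0; last first.
    by move=> j /fS.
  rewrite -big_filter; apply: perm_big; apply: uniq_perm => //.
    exact: filter_uniq (zs_uniq n).
  move=> j; rewrite mem_filter andb_idr // => /Sn0.
  by rewrite !mem_zs => /leq_trans; apply.
rewrite /cser; set z := \sum_(j <- S) f j in E *.
have -> : limn (fun n => complex.Re (psum f n)) = complex.Re z.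
  by apply: cvg_lim => //; apply: cvg_near_cst; exists n0 => // n /= /E ->.
have -> : limn (fun n => complex.Im (psum f n)) = complex.Im z.
  by apply: cvg_lim => //; apply: cvg_near_cst; exists n0 => // n /= /E ->.
by case: z {E}.
Qed.

(** A Fatou-type passage to the limit: the sum over [T] is finite, so a bound valid for every
    truncation of the inner series survives. *)
Lemma cabs_sq_cser (I : Type) (T : seq I) (F : I -> int -> R[i]) (w : I -> R) B :
  (forall m, exists A, bsum (fun j => cabs (F m j)) A) ->
  (forall n, \sum_(m <- T) cabs (psum (F m) n) ^+ 2 * w m <= B) ->
  \sum_(m <- T) cabs (cser (F m)) ^+ 2 * w m <= B.
Proof.
move=> FA H.
suff C : (fun n => \sum_(m <- T) cabs (psum (F m) n) ^+ 2 * w m) @ \oo -->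
    \sum_(m <- T) cabs (cser (F m)) ^+ 2 * w m.
  rewrite -(cvg_lim _ C) //; apply: limr_le; first by apply/cvg_ex; eexists; exact: C.
  by apply: nearW.
elim: T {H} => [|m T IH].
  by under eq_fun do rewrite big_nil; rewrite big_nil; exact: cvg_cst.
under eq_fun do rewrite big_cons; rewrite big_cons.
apply: cvgD => //; apply: cvgMl.
under eq_fun do rewrite cabs_sqE; rewrite cabs_sqE.
have [A mA] := FA m.
under eq_fun do rewrite !expr2; rewrite !expr2.
have re := Re_cser mA; have im := Im_cser mA.
by apply: cvgD; apply: cvgM.
Qed.

End BilateralSeries.

(** * Convolution estimates and multiplication on Sobolev spaces *)

Section Multiplication.
Variable R : realType.
Implicit Types (u v b : seqZ R) (S T : seq int).

Section Young.
Variables (al up : int -> R) (A B : R).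
Hypotheses (al0 : forall j, 0 <= al j) (up0 : forall j, 0 <= up j).

(** Cauchy-Schwarz with weights [al (m - j)], each of total mass at most [A]; exchanging the sums
    uses the l^1 bound a second time. *)
Lemma young_l1_l2 S T : bsum al A -> bsum (fun j => up j ^+ 2) B -> uniq S -> uniq T ->
  \sum_(m <- T) (\sum_(j <- S) al (m - j) * up j) ^+ 2 <= A ^+ 2 * B.
Proof.
move=> aA uB uS uT.
have A0 := bsum_ge0 aA.
apply: (@le_trans _ _ (\sum_(m <- T) A * \sum_(j <- S) al (m - j) * up j ^+ 2)).
  apply: ler_sum => m _; apply: le_trans (sum_cauchy _ _ _) _ => //.
  apply: ler_wpM2r; first by apply: sumr_ge0 => j _; rewrite mulr_ge0 ?sqr_ge0.
  exact: (bsum_reflect m aA) uS.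
rewrite -mulr_sumr expr2 -mulrA ler_wpM2l // exchange_big /=.
apply: (@le_trans _ _ (\sum_(j <- S) A * up j ^+ 2)).
  apply: ler_sum => j _; rewrite -mulr_suml ler_wpM2r ?sqr_ge0 //.
  exact: (bsum_shift (- j) aA) uT.
by rewrite -mulr_sumr ler_wpM2l // uB.
Qed.

(** The same argument with [up] as the Cauchy-Schwarz weight. *)
Lemma young_l2_l1 S T : bsum (fun j => al j ^+ 2) B -> bsum up A -> uniq S -> uniq T ->
  \sum_(m <- T) (\sum_(j <- S) al (m - j) * up j) ^+ 2 <= A ^+ 2 * B.
Proof.
move=> aB uA uS uT.
have A0 := bsum_ge0 uA.
apply: (@le_trans _ _ (\sum_(m <- T) A * \sum_(j <- S) up j * al (m - j) ^+ 2)).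
  apply: ler_sum => m _; under eq_bigr do rewrite mulrC.
  apply: le_trans (sum_cauchy _ _ _) _ => //.
  apply: ler_wpM2r; first by apply: sumr_ge0 => j _; rewrite mulr_ge0 ?sqr_ge0.
  exact: uA.
rewrite -mulr_sumr expr2 -mulrA ler_wpM2l // exchange_big /=.
apply: (@le_trans _ _ (\sum_(j <- S) up j * B)).
  apply: ler_sum => j _; rewrite -mulr_sumr ler_wpM2l //.
  exact: (bsum_shift (- j) aB) uT.
rewrite -mulr_suml ler_wpM2r ?(bsum_ge0 aB) //; exact: uA.
Qed.

End Young.

Lemma conv_summable b u m : inH 0 b -> inH 0 u ->
  exists A, bsum (fun j => cabs (b (m - j) * u j)) A.
Proof.
move=> /inHP[A bA] /inHP[B uB]; exists (A + B).
apply: bsum_le (lexx _) (bsumD (bsum_reflect m bA) uB) => j /=.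
rewrite !wt0 !mulr1 cabsM.
have := sqr_ge0 (cabs (b (m - j)) - cabs (u j)).
have := cabs_ge0 (b (m - j)); have := cabs_ge0 (u j).
by rewrite !expr2; nra.
Qed.

(** Reduces estimates for the convolution series to finite sums of moduli, where the Young
    inequalities apply. *)
Lemma mulZ_N2 b u (s : R) B : inH 0 b -> inH 0 u ->
  (forall S T, uniq S -> uniq T ->
    \sum_(m <- T) (\sum_(j <- S) cabs (b (m - j)) * cabs (u j)) ^+ 2 * wt s m <= B) ->
  N2 s (mulZ b u) B.
Proof.
move=> Hb Hu H T uT.
apply: cabs_sq_cser => [m|n]; first exact: conv_summable.
apply: le_trans (H (zs n) T (zs_uniq n) uT).
apply: ler_sum => m _; rewrite ler_wpM2r ?wt_ge0 //.
rewrite lerXn2r ?nnegrE ?cabs_ge0 ?sumr_ge0 //.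
  by move=> j _; rewrite mulr_ge0 ?cabs_ge0.
rewrite psumE; apply: le_trans (cabs_sum _ _) _.
by under eq_bigr do rewrite cabsM.
Qed.

(** Membership in H^0 makes the three convolution series absolutely convergent, so the limits in
    [cser] can be added. *)
Lemma mulZD b u v m : inH 0 b -> inH 0 u -> inH 0 v ->
  mulZ b (fun j => u j + v j) m = mulZ b u m + mulZ b v m.
Proof.
move=> Hb Hu Hv; rewrite /mulZ.
have [A HA] := conv_summable m Hb Hu; have [B HB] := conv_summable m Hb Hv.
rewrite -(cserD HA HB); congr cser; apply/funext => j; exact: mulrDr.
Qed.

(** Cauchy-Schwarz against the weight max(1,|j|)^(-2), whose sum is at most 5. *)
Lemma N2_1_l1 b A : N2 1 b A -> bsum (fun j => cabs (b j)) (Num.sqrt (5 * A)).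
Proof.
move=> bA S uS; have A0 := bsum_ge0 bA.
rewrite -(ger0_norm (sumr_ge0 _ (fun j _ => cabs_ge0 (b j)))) -sqrtr_sqr.
apply: ler_wsqrtr.
have E j : cabs (b j) = wt (-1) j * (cabs (b j) * wt 1 j).
  by rewrite mulrCA wtN mulVf ?mulr1 // gt_eqF ?wt_gt0.
under eq_bigr do rewrite E.
apply: le_trans (sum_cauchy _ _ _) _ => [j|]; first exact: wt_ge0.
apply: ler_pM.
- by apply: sumr_ge0 => j _; exact: wt_ge0.
- by apply: sumr_ge0 => j _; rewrite mulr_ge0 ?wt_ge0 ?sqr_ge0.
- exact: bsum_wtN1.
apply: le_trans (bA S uS); apply: ler_sum => j _.
rewrite exprMn mulrCA ler_wpM2l ?sqr_ge0 // wtN expr2 mulrA mulVf ?mul1r //.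
by rewrite gt_eqF ?wt_gt0.
Qed.

(** Coefficients in H^1 have l^1 Fourier series, and l^1 convolves l^2 into l^2. *)
Lemma mulZ_bounded0 b : inH 1 b ->
  exists C, 0 <= C /\ forall u B, N2 0 u B -> N2 0 (mulZ b u) (C * B).
Proof.
move=> Hb; have /inHP[A bA] := Hb.
exists (Num.sqrt (5 * A) ^+ 2); split; first exact: sqr_ge0.
move=> u B uB; apply: mulZ_N2 => [||S T uS uT].
- exact: inH_mono ler01 Hb.
- exact: N2_inH uB.
under eq_bigr do rewrite wt0 mulr1.
apply: (@young_l1_l2 (fun j => cabs (b j)) (fun j => cabs (u j))) => //.
- by move=> j; exact: cabs_ge0.
- exact: N2_1_l1.
by apply: bsum_le (lexx _) uB => j; rewrite wt0 mulr1.
Qed.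

(** H^s is an algebra for s >= 1. By [wt_sub] the weight falls on [b] (the sum [X]) or on [u] (the
    sum [Y]); the factor left without weight is in l^1 since it lies in H^1. *)
Lemma mulZ_bounded (s : R) b : 1 <= s -> inH s b ->
  exists C, 0 <= C /\ forall u B, N2 s u B -> N2 s (mulZ b u) (C * B).
Proof.
move=> s1 Hb; have /inHP[A bA] := Hb; have A0 := bsum_ge0 bA.
have s0 : 0 <= s by apply: le_trans s1.
have D0 : 0 <= (2 `^ s) ^+ 2 :> R by rewrite sqr_ge0.
(* 20 = 2 * 5 + 2 * 5: the sums of [X] and of [Y] each contribute 5 A B, doubled by [sqrD_le2]. *)
exists ((2 `^ s) ^+ 2 * (20 * A)); split; first by rewrite mulr_ge0 // mulr_ge0.
move=> u B uB; have B0 := bsum_ge0 uB.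
apply: mulZ_N2 => [||S T uS uT].
- exact: inH_mono s0 Hb.
- exact: inH_mono s0 (N2_inH uB).
pose X m := \sum_(j <- S) (cabs (b (m - j)) * jb (m - j) `^ s) * cabs (u j).
pose Y m := \sum_(j <- S) cabs (b (m - j)) * (cabs (u j) * jb j `^ s).
have XY m : (\sum_(j <- S) cabs (b (m - j)) * cabs (u j)) ^+ 2 * wt s m <=
    (2 `^ s) ^+ 2 * (2 * X m ^+ 2 + 2 * Y m ^+ 2).
  rewrite wtE -exprMn.
  apply: (@le_trans _ _ ((2 `^ s * (X m + Y m)) ^+ 2)); last first.
    by rewrite exprMn ler_wpM2l // sqrD_le2.
  have X0 : 0 <= X m by apply: sumr_ge0 => j _; rewrite !mulr_ge0 ?cabs_ge0 ?powR_ge0.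
  have Y0 : 0 <= Y m by apply: sumr_ge0 => j _; rewrite !mulr_ge0 ?cabs_ge0 ?powR_ge0.
  apply: lerXn2r; rewrite ?nnegrE.
  - by rewrite mulr_ge0 ?powR_ge0 // sumr_ge0 // => j _; rewrite mulr_ge0 ?cabs_ge0.
  - by rewrite mulr_ge0 ?powR_ge0 // addr_ge0.
  have -> : X m + Y m = \sum_(j <- S) ((cabs (b (m - j)) * jb (m - j) `^ s) * cabs (u j) +
      cabs (b (m - j)) * (cabs (u j) * jb j `^ s)) by rewrite big_split.
  rewrite mulr_suml mulr_sumr; apply: ler_sum => j _ /=.
  have := wt_sub (m - j) j s0; rewrite subrK.
  move/(ler_wpM2l (mulr_ge0 (cabs_ge0 (b (m - j))) (cabs_ge0 (u j)))).
  by move=> /le_trans; apply; rewrite le_eqVlt; apply/orP; left; apply/eqP; ring.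
apply: le_trans (ler_sum _ (fun m _ => XY m)) _.
rewrite -mulr_sumr big_split -!mulr_sumr /=.
have sq5 x : 0 <= x -> Num.sqrt (5 * x) ^+ 2 = 5 * x :> R.
  by move=> x0; rewrite sqr_sqrtr // mulr_ge0.
have HX : \sum_(m <- T) X m ^+ 2 <= 5 * B * A.
  rewrite -sq5 //.
  apply: (@young_l2_l1 (fun j => cabs (b j) * jb j `^ s) (fun j => cabs (u j))) => //.
  - by move=> j; exact: cabs_ge0.
  - by apply: bsum_le (lexx _) bA => j; rewrite exprMn -wtE.
  - exact: N2_1_l1 (N2_mono s1 uB).
have HY : \sum_(m <- T) Y m ^+ 2 <= 5 * A * B.
  rewrite -sq5 //.
  apply: (@young_l1_l2 (fun j => cabs (b j)) (fun j => cabs (u j) * jb j `^ s)) => //.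
  - by move=> j; exact: cabs_ge0.
  - exact: N2_1_l1 (N2_mono s1 bA).
  - by apply: bsum_le (lexx _) uB => j; rewrite exprMn -wtE.
rewrite -[leRHS]mulrA; apply: ler_wpM2l => //; lra.
Qed.

End Multiplication.

(** * Mapping properties of derivatives, of L1 and of the symbol of L0 *)

Section Operators.
Variable R : realType.
Implicit Types (u v : seqZ R) (s : R).

Lemma cabs_ij d (j : int) : cabs (('i * j%:~R : R[i]) ^+ d) <= jb j ^+ d.
Proof.
rewrite cabsX cabsM cabs_i mul1r cabs_int.
by apply: lerXn2r; rewrite ?nnegrE ?jb_ge0 // jb_norm.
Qed.

Lemma derivZ_N2 (d p : nat) s u B : (d <= p)%N -> N2 (p%:R + s) u B ->
  N2 s (Defs.derivZ d u) B.
Proof.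
move=> dp; apply: bsum_le => // j.
rewrite /Defs.derivZ cabsM exprMn wtD [leRHS]mulrA.
apply: ler_wpM2r; first exact: wt_ge0.
rewrite mulrC ler_wpM2l ?sqr_ge0 // wt_nat.
apply: lerXn2r; rewrite ?nnegrE ?cabs_ge0 ?exprn_ge0 ?jb_ge0 //.
by apply: le_trans (cabs_ij d j) _; rewrite ler_weXn2l // jb_ge1.
Qed.

Section VariableCoefficients.
Variables (a : nat -> seqZ R) (p : nat).

(** Here [C] bounds the square of the operator norm from H^(p+s) to H^s. *)
Definition L1_bounded s C := 0 <= C /\
  forall u B, N2 (p%:R + s) u B -> N2 s (L1op a p u) (C * B).

Lemma L1_boundedP s :
  (forall d, (d <= p)%N -> exists C, 0 <= C /\
     forall u B, N2 s u B -> N2 s (mulZ (a d) u) (C * B)) ->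
  exists C, L1_bounded s C.
Proof.
move=> H.
have : forall n, (n <= p.+1)%N -> exists C, 0 <= C /\ forall u B, N2 (p%:R + s) u B ->
    N2 s (fun m => \sum_(0 <= d < n) mulZ (a d) (Defs.derivZ d u) m) (C * B).
  elim=> [|n IH] np.
    exists 0; split => // u B _; rewrite mul0r.
    by apply: bsum_le (lexx _) (@N2_0 R s) => j; rewrite big_nil.
  have np' : (n <= p)%N by [].
  have [C [C0 HC]] := IH (ltnW np); have [D [D0 HD]] := H n np'.
  exists (2 * C + 2 * D); split; first by rewrite addr_ge0 // mulr_ge0.
  move=> u B uB; rewrite mulrDl -!mulrA.
  have := N2D (HC u B uB) (HD _ _ (derivZ_N2 np' uB)).
  by apply: bsum_le => // j; rewrite big_nat_recr.
by move=> /(_ p.+1 (leqnn _)).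
Qed.

Lemma L1_bounded0 : (forall d, (d <= p)%N -> inH 1 (a d)) -> exists C, L1_bounded 0 C.
Proof. by move=> Ha; apply: L1_boundedP => d dp; apply: mulZ_bounded0; exact: Ha. Qed.

Lemma L1_bounded_ge1 s : 1 <= s -> (forall d, (d <= p)%N -> inH s (a d)) ->
  exists C, L1_bounded s C.
Proof. by move=> s1 Ha; apply: L1_boundedP => d dp; apply: mulZ_bounded => //; exact: Ha. Qed.

Lemma L1opD u v m : (forall d, (d <= p)%N -> inH 0 (a d)) ->
  inH p%:R u -> inH p%:R v ->
  L1op a p (fun j => u j + v j) m = L1op a p u m + L1op a p v m.
Proof.
move=> Ha Hu Hv; rewrite /L1op -big_split /=; apply: eq_big_nat => d /andP[_ dp].
have D (w : seqZ R) : inH p%:R w -> inH 0 (Defs.derivZ d w).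
  move=> /inHP[B]; rewrite -[p%:R]addr0 => wB.
  exact: N2_inH (derivZ_N2 (dp : (d <= p)%N) wB).
have -> : Defs.derivZ d (fun j => u j + v j) =
    (fun j => Defs.derivZ d u j + Defs.derivZ d v j).
  by apply/funext => j; exact: mulrDr.
exact: mulZD m (Ha d dp) (D u Hu) (D v Hv).
Qed.

(** For finitely supported [u] the convolution series are finite sums, so L1 acts as a matrix. This
    serves both the Galerkin matrix and the test vectors e_m. *)
Lemma L1op_finite u (S : seq int) m : uniq S -> (forall j, j \notin S -> u j = 0) ->
  L1op a p u m =
  \sum_(j <- S) (\sum_(0 <= d < p.+1) a d (m - j) * ('i * j%:~R) ^+ d) * u j.
Proof.
move=> uS uSu; rewrite /L1op.
under [RHS]eq_bigr do rewrite mulr_suml.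
rewrite exchange_big; apply: eq_bigr => d _.
rewrite /mulZ (cser_finite uS) => [|j /uSu]; last by rewrite /Defs.derivZ => ->; rewrite !mulr0.
by apply: eq_bigr => j _; rewrite /Defs.derivZ mulrA.
Qed.

End VariableCoefficients.

Section Symbol.
Variables (c : nat -> R[i]) (q k : nat).
Hypotheses (qk : (q <= k)%N) (k1 : (1 <= k)%N) (ck : c k != 0).

Lemma symb_upper_gen n : exists C, 0 <= C /\
  forall j, cabs (\sum_(q <= d < n.+1) c d * ('i * j%:~R) ^+ d) <= C * jb j ^+ n.
Proof.
exists (\sum_(q <= d < n.+1) cabs (c d)); split.
  by apply: sumr_ge0 => d _; exact: cabs_ge0.
move=> j; apply: le_trans (cabs_sum _ _) _; rewrite mulr_suml.
apply: ler_sum_nat => d /andP[_ dn].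
rewrite cabsM ler_wpM2l ?cabs_ge0 //.
by apply: le_trans (cabs_ij d j) _; rewrite ler_weXn2l // jb_ge1.
Qed.

Lemma symb_upper : exists C, 0 <= C /\ forall j, cabs (symb c q k j) <= C * jb j ^+ k.
Proof. exact: symb_upper_gen. Qed.

(** At high frequency the leading term c_k (ij)^k dominates: the lower terms and [z] together take
    away at most half of it. *)
Lemma symb_lower (z : R[i]) : exists n0 : nat, forall j, n0%:R <= jb j :> R ->
  cabs (c k) / 2 * jb j ^+ k <= cabs (symb c q k j - z).
Proof.
have ck0 : 0 < cabs (c k) by rewrite cabs_gt0.
have [C [C0 HC]] : exists C, 0 <= C /\ forall j : int,
    cabs (\sum_(q <= d < k) c d * ('i * j%:~R) ^+ d) <= C * jb j ^+ k.-1.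
  by have [C HC] := symb_upper_gen k.-1; exists C; rewrite prednK in HC.
pose D := C + cabs z.
have D0 : 0 <= D by rewrite addr_ge0 ?cabs_ge0.
(* Beyond 2 D / |c_k| the lower terms are at most half the leading one; the extra unit in [.+2]
   forces the bracket above 1, where it equals |j|. *)
exists (Num.truncn (2 * D / cabs (c k))).+2 => j nj.
have jD : 2 * D <= cabs (c k) * jb j.
  rewrite -ler_pdivrMl // mulrC; apply: le_trans nj.
  apply: (@le_trans _ _ (Num.truncn (2 * D / cabs (c k))).+1%:R); last by rewrite ler_nat.
  by rewrite ltW // truncnS_gt.
have j2 : 1 < jb j :> R by apply: lt_le_trans nj; rewrite ltr1n.
have jE : cabs (('i * j%:~R : R[i]) ^+ k) = jb j ^+ k.
  rewrite cabsX cabsM cabs_i mul1r cabs_int; congr (_ ^+ _).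
  move: j2; rewrite /jb lt_max ltxx /= => j2.
  by rewrite -intr_norm max_r // ltW.
rewrite /symb big_nat_recr //= -addrA [_ + (_ - _)]addrCA.
have -> : c k * ('i * j%:~R) ^+ k + (\sum_(q <= d < k) c d * ('i * j%:~R) ^+ d - z) =
   c k * ('i * j%:~R) ^+ k - (z - \sum_(q <= d < k) c d * ('i * j%:~R) ^+ d) by ring.
apply: le_trans (ler_cabsB _ _).
rewrite cabsM jE.
have : cabs (z - \sum_(q <= d < k) c d * ('i * j%:~R) ^+ d) <= D * jb j ^+ k.-1.
  apply: le_trans (ler_cabsD _ _) _; rewrite cabsN /D mulrDl addrC lerD ?HC //.
  by rewrite ler_peMr ?cabs_ge0 // exprn_ege1 ?jb_ge1.
have -> : jb j ^+ k = jb j * jb j ^+ k.-1 :> R by rewrite -exprS prednK.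
have := exprn_ge0 k.-1 (jb_ge0 R j).
move: (jb j ^+ k.-1) => x x0; nra.
Qed.

(** Only finitely many frequencies escape [symb_lower], and on those a minimum of positive numbers
    is taken. *)
Lemma symb_away (z : R[i]) : (forall m : int, z != symb c q k m) ->
  exists e, 0 < e /\ forall j, e <= cabs (symb c q k j - z).
Proof.
move=> zs0; have [n0 Hn0] := symb_lower z.
have ck0 : 0 < cabs (c k) / 2 by rewrite divr_gt0 // cabs_gt0.
have [e [e0 He]] : exists e, 0 < e /\ forall j, j \in zs n0 -> e <= cabs (symb c q k j - z).
  elim: (zs n0) => [|i S [e [e0 He]]]; first by exists 1.
  exists (Num.min e (cabs (symb c q k i - z))); split.
    by rewrite lt_min e0 cabs_gt0 subr_eq0 eq_sym zs0.
  by move=> j; rewrite inE ge_min => /predU1P[->|/He ->]; rewrite ?lexx ?orbT.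
exists (Num.min e (cabs (c k) / 2)); split; first by rewrite lt_min e0.
move=> j; rewrite ge_min; have [jn|jn] := boolP (j \in zs n0).
  by rewrite He.
apply/orP; right; apply: le_trans (Hn0 j _).
  by rewrite ler_peMr ?exprn_ege1 ?jb_ge1 // ltW.
by apply: jb_ge; move: jn; rewrite mem_zs -ltnNge => /ltnW.
Qed.

End Symbol.

Lemma inPN_jb N j : (0 < N)%N -> inPN N j -> jb j <= N%:R :> R.
Proof. by move=> N0 /andP[? ?]; apply: jb_le => //; lia. Qed.

Lemma notinPN_jb N j : ~~ inPN N j -> N%:R / 2 <= jb j :> R.
Proof.
move=> jN; have H : (N <= 2 * `|j|%N)%N by move: jN; rewrite /inPN; lia.
have := @jb_ge R `|j|%N j (leqnn _); rewrite ler_pdivrMr // => /(ler_wpM2r (ler0n R 2)).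
by apply: le_trans; rewrite -natrM ler_nat mulnC.
Qed.

Lemma inPN_zs N j : inPN N j -> j \in zs N.
Proof. by rewrite mem_zs /inPN => /andP[? ?]; lia. Qed.

Lemma inH_PN N s u : (forall j, ~~ inPN N j -> u j = 0) -> inH s u.
Proof.
move=> uN; apply: (@inH_finite _ _ _ (zs N)) => j jz; apply: uN.
by apply: contra jz; exact: inPN_zs.
Qed.

End Operators.

(** * Approximate eigenvectors of L built from Galerkin eigenvectors *)

Section PseudospectrumBound.
Variable R : realType.
Variables (c : nat -> R[i]) (q k p : nat) (a : nat -> seqZ R).
Hypotheses (k1 : (1 <= k)%N) (pk : (p < k)%N) (qk : (q <= k)%N) (ck : c k != 0).
Implicit Types (u v w : seqZ R) (x e : R) (N : nat).

Lemma powRDp x e e' : 0 < x -> x `^ (e + e') = x `^ e * x `^ e'.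
Proof. by move=> x0; rewrite powRD // (lt0r_neq0 x0) implybT. Qed.

Lemma powR_half x e : 0 < x -> (x / 2) `^ e = 2 `^ (- e) * x `^ e.
Proof.
move=> x0; rewrite powRM ?ltW // mulrC; congr (_ * _).
by rewrite -powR_inv1 // -powRrM mulN1r.
Qed.

Definition galerkin N lam u := (forall j, ~~ inPN N j -> u j = 0) /\
  forall j, L0op c q k u j + PN N (L1op a p u) j = lam * u j.

(* A trial vector of this kind forces the norm of the resolvent from H^(s-k) to H^s
   to be at least of order N^(k-p). *)
Definition quasimode (s : R) N lam D := exists w, [/\ inH s w, exists j, w j != 0 &
  N2 (s - k%:R) (zminusL c q k a p lam w)
     (D * N%:R `^ (2 * (p%:R - k%:R)) * nrm2 s w)].

Lemma quasimode_le s N lam D D' : D <= D' -> quasimode s N lam D -> quasimode s N lam D'.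
Proof.
move=> DD [w [Hw w0 H]]; exists w; split => //; apply: N2_le H.
by rewrite !ler_wpM2r ?nrm2_ge0 ?powR_ge0.
Qed.

Lemma zminusL_galerkin N lam u j : galerkin N lam u ->
  zminusL c q k a p lam u j = if inPN N j then 0 else - L1op a p u j.
Proof.
move=> [uN uE]; rewrite /zminusL /Lop -(uE j) /PN.
by case: ifP => _; ring.
Qed.

Section FixedIndex.
Variables (rho C : R).
Hypotheses (rho1 : 1 <= rho) (HC : L1_bounded a p rho C)
  (Ha0 : forall d, (d <= p)%N -> inH 0 (a d)).
Variable s : R.
Hypothesis srho : s - k%:R <= rho.

Let r := s - k%:R.
Let t := p%:R + rho.
Let P N e := (N%:R : R) `^ (2 * e).

Let C0 : 0 <= C. Proof. exact: HC.1. Qed.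

Let PD N e e' : (0 < N)%N -> P N (e + e') = P N e * P N e'.
Proof. by move=> N0; rewrite /P mulrDr powRDp // ltr0n. Qed.

(** The residual lives on frequencies at least N/2, where replacing the weight of index [rho] by
    that of [r] <= [rho] costs at most (N/2)^(2(r - rho)). *)
Lemma residual_N2 N lam u B : (0 < N)%N -> galerkin N lam u -> N2 t u B ->
  N2 r (zminusL c q k a p lam u) (2 `^ (2 * (rho - r)) * P N (r - rho) * (C * B)).
Proof.
move=> N0 uG uB; have [_ /(_ u B uB) H] := HC.
have N0' : 0 < N%:R / 2 :> R by rewrite divr_gt0 ?ltr0n.
apply: N2_dom H; first by rewrite mulr_ge0 ?powR_ge0.
move=> j; rewrite (zminusL_galerkin j uG); case: ifPn => [_|jN].
  by rewrite cabs0 expr0n mul0r mulr_ge0 ?en_ge0 // mulr_ge0 ?powR_ge0.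
rewrite cabsN mulrCA ler_wpM2l ?sqr_ge0 // -{1}(subrK rho r) wtD ler_wpM2r ?wt_ge0 //.
apply: le_trans (wt_tail N0' (notinPN_jb _ jN) _) _; first by rewrite subr_le0.
by rewrite powR_half ?ltr0n // -mulrN opprB.
Qed.

(** Bernstein's inverse inequality on ran PN. *)
Lemma head_N2 N u B e e' : (0 < N)%N -> (forall j, ~~ inPN N j -> u j = 0) -> e <= e' ->
  N2 e u B -> N2 e' u (P N (e' - e) * B).
Proof.
move=> N0 uN ee uB; apply: N2_dom uB; first exact: powR_ge0.
move=> j; have [jN|jN] := boolP (inPN N j); last first.
  by rewrite uN // cabs0 expr0n !mul0r mulr0.
rewrite mulrCA ler_wpM2l ?sqr_ge0 // -{1}(subrK e e') wtD ler_wpM2r ?wt_ge0 //.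
by apply: wt_head; rewrite ?inPN_jb // subr_ge0.
Qed.

(** The vector [u] itself serves: the gain r - rho of the residual and the loss t - s of the
    hypothesis add up to p - k. *)
Lemma quasimode_galerkin N lam u E : (0 < N)%N -> 0 <= E -> galerkin N lam u ->
  (exists j, u j != 0) -> nrm2 t u <= E * P N (t - s) * nrm2 s u ->
  quasimode s N lam (2 `^ (2 * (rho - r)) * C * E).
Proof.
move=> N0 E0 uG u0 uE; exists u; split => //; first exact: inH_PN uG.1.
apply: N2_le (residual_N2 N0 uG (nrm2P (inH_PN _ uG.1))).
apply: (@le_trans _ _ (2 `^ (2 * (rho - r)) * P N (r - rho) * (C * (E * P N (t - s) * nrm2 s u)))).
  by rewrite ler_wpM2l ?mulr_ge0 ?powR_ge0 // ler_wpM2l.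
rewrite -/(P N (p%:R - k%:R)) (_ : p%:R - k%:R = (r - rho) + (t - s)); last first.
  by rewrite /r /t; ring.
by rewrite [P N (r - rho + (t - s))]PD // le_eqVlt; apply/orP; left; apply/eqP; ring.
Qed.

Lemma quasimode_le_index N lam u : s <= t -> (0 < N)%N -> galerkin N lam u ->
  (exists j, u j != 0) -> quasimode s N lam (2 `^ (2 * (rho - r)) * C * 1).
Proof.
move=> st N0 uG u0; have [uN _] := uG.
apply: (quasimode_galerkin N0 ler01 uG u0); rewrite mul1r.
by apply: nrm2_le; apply: (head_N2 N0 uN st); exact: nrm2P (inH_PN _ uN).
Qed.

Section HighIndex.
Hypothesis ts : t <= s.

Let nrm2_ts u : inH s u -> nrm2 t u <= nrm2 s u.
Proof. by move=> Hu; apply: nrm2_le; apply: N2_mono ts _; exact: nrm2P. Qed.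

(** For N <= N0 the factor N^(p-k) is bounded below, so boundedness of L1 suffices and the constant
    absorbs N0^(2(k-p)). *)
Lemma quasimode_small_N N0 N lam u : (0 < N <= N0)%N -> galerkin N lam u ->
  (exists j, u j != 0) -> quasimode s N lam (C * P N0 (k%:R - p%:R)).
Proof.
move=> /andP[Npos NN0] uG u0; have Hu e : inH e u by exact: inH_PN uG.1.
exists u; split => //.
have H : N2 rho (L1op a p u) (C * nrm2 t u) by apply: HC.2; exact: nrm2P.
apply: (@N2_le _ _ _ (1 * (C * nrm2 t u))).
  rewrite mul1r -!mulrA ler_wpM2l //; apply: le_trans (nrm2_ts (Hu s)) _.
  rewrite mulrA ler_peMl ?nrm2_ge0 // -/(P N (p%:R - k%:R)).
  apply: (@le_trans _ _ (P N (k%:R - p%:R) * P N (p%:R - k%:R))).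
    by rewrite -PD // addrA subrK subrr /P mulr0 powRr0.
  rewrite ler_wpM2r ?powR_ge0 //; apply: ge0_ler_powR; rewrite ?nnegrE ?ler0n ?ler_nat //.
  by rewrite mulr_ge0 // subr_ge0 ler_nat ltnW.
apply: N2_dom (ler01) _ H => j; rewrite mul1r (zminusL_galerkin j uG).
case: ifP => _; first by rewrite cabs0 expr0n mul0r en_ge0.
by rewrite cabsN ler_wpM2l ?sqr_ge0 // wt_mono.
Qed.

Section Thresholds.
Variables (ga c0 : R).
Hypotheses (ga0 : 0 < ga) (c00 : 0 < c0) (c0E : c0 = ga / 2 / 2 ^+ k).

(* Low eigenvalues: correct u above the cut-off by solving (lam - L0) v = (1 - PN) L1 u,
   so that the residual becomes - L1 v. *)
Lemma quasimode_low n0 N lam u :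
  (forall j, n0%:R <= jb j :> R -> ga * jb j ^+ k <= cabs (symb c q k j - 0)) ->
  (0 < N)%N -> (2 * n0 <= N)%N -> galerkin N lam u -> (exists j, u j != 0) ->
  cabs lam < c0 * N%:R ^+ k ->
  quasimode s N lam (C * (4 / ga ^+ 2 * 2 `^ (2 * (k%:R - p%:R)) * C)).
Proof.
move=> Hn0 N0 nN uG [j0 u0] lamN; have Hu e : inH e u by exact: inH_PN uG.1.
have N0' : 0 < N%:R / 2 :> R by rewrite divr_gt0 ?ltr0n.
(* By the choice of [c0], |lam| is below (ga/2) (N/2)^k, hence below half of the lower bound for the
   symbol at frequencies at least N/2. *)
have sep j : ~~ inPN N j -> ga / 2 * jb j ^+ k <= cabs (lam - symb c q k j).
  move=> jN; have jN2 := notinPN_jb R jN.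
  have : ga * jb j ^+ k <= cabs (symb c q k j).
    rewrite -[symb _ _ _ _]subr0; apply: Hn0; apply: le_trans jN2.
    by rewrite ler_pdivlMr // -natrM ler_nat mulnC.
  have : cabs lam <= ga / 2 * jb j ^+ k.
    apply: ltW; apply: lt_le_trans lamN _.
    rewrite c0E -mulrA ler_pM2l ?divr_gt0 // mulrC -expr_div_n.
    by apply: lerXn2r; rewrite ?nnegrE ?jb_ge0 // ltW.
  by have := ler_cabsB (symb c q k j) lam; rewrite (cabs_distC _ lam); lra.
pose v j := if inPN N j then 0 else L1op a p u j / (lam - symb c q k j).
have vle j : cabs (v j) ^+ 2 * wt k%:R j <= 4 / ga ^+ 2 * cabs (L1op a p u j) ^+ 2.
  rewrite /v; case: ifPn => [_|jN].
    by rewrite cabs0 expr0n mul0r mulr_ge0 ?sqr_ge0 // divr_ge0 ?sqr_ge0.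
  rewrite cabsM cabsV wt_nat -exprMn -[4](_ : 2 ^+ 2 = 4); last by rewrite expr2 -natrM.
  rewrite -expr_div_n -exprMn; apply: lerXn2r; rewrite ?nnegrE.
  - by rewrite !mulr_ge0 ?invr_ge0 ?cabs_ge0 ?exprn_ge0 ?jb_ge0.
  - by rewrite mulr_ge0 ?divr_ge0 ?cabs_ge0 ?ltW.
  rewrite -mulrA [leRHS]mulrC ler_wpM2l ?cabs_ge0 //.
  have x0 : 0 < cabs (lam - symb c q k j).
    by apply: lt_le_trans (sep j jN); rewrite mulr_gt0 ?divr_gt0 // exprn_gt0 ?jb_gt0.
  rewrite ler_pdivrMl // mulrC -ler_pdivrMl ?divr_gt0 // invf_div.
  exact: sep.
have HL : N2 rho (L1op a p u) (C * nrm2 t u) by apply: HC.2; exact: nrm2P.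
have g0 : 0 <= 4 / ga ^+ 2 by rewrite divr_ge0 ?sqr_ge0.
(* Regularity of [v]: dividing by lam - L0 gains k derivatives, and s <= rho + k, so [v] lies in
   H^s. *)
have Hvk : N2 (rho + k%:R) v (4 / ga ^+ 2 * (C * nrm2 t u)).
  apply: N2_dom HL => // j.
  rewrite wtD [leLHS](_ : _ = cabs (v j) ^+ 2 * wt k%:R j * wt rho j); last by ring.
  rewrite [leRHS]mulrA; apply: ler_wpM2r; first exact: wt_ge0.
  exact: vle.
(* Smallness of [v]: its norm in H^t spends p of the k derivatives gained, and the other k - p
   become a power of N because [v] lives above the cut-off. *)
have Hvt : N2 t v (4 / ga ^+ 2 * 2 `^ (2 * (k%:R - p%:R)) * P N (p%:R - k%:R) *
    (C * nrm2 t u)).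
  apply: N2_dom HL => [|j]; first by rewrite mulr_ge0 ?powR_ge0 // mulr_ge0 ?powR_ge0.
  have [jN|jN] := boolP (inPN N j).
    by rewrite /v jN cabs0 expr0n mul0r !mulr_ge0 ?powR_ge0 ?invr_ge0 ?cabs_ge0 ?sqr_ge0 ?wt_ge0.
  rewrite (_ : t = (p%:R - k%:R) + k%:R + rho); last by rewrite subrK.
  rewrite 2!wtD.
  rewrite [leLHS](_ : _ = cabs (v j) ^+ 2 * wt k%:R j * wt (p%:R - k%:R) j * wt rho j);
    last by ring.
  rewrite [leRHS](_ : _ = 4 / ga ^+ 2 * cabs (L1op a p u j) ^+ 2 *
     (2 `^ (2 * (k%:R - p%:R)) * P N (p%:R - k%:R)) * wt rho j); last by ring.
  apply: ler_wpM2r; first exact: wt_ge0.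
  apply: ler_pM; rewrite ?vle ?wt_ge0 ?en_ge0 //.
  apply: le_trans (wt_tail N0' (notinPN_jb _ jN) _) _.
    by rewrite subr_le0 ler_nat ltnW.
  by rewrite powR_half ?ltr0n // -mulrN opprB.
have Hv : inH s v by apply: inH_mono (N2_inH Hvk); rewrite -lerBlDr.
pose w j := u j + v j.
have Hw : inH s w by apply: inHD.
(* The supports of [u] and [v] are disjoint, so adding [v] cannot shrink the norm. *)
have uw : nrm2 s u <= nrm2 s w.
  apply: nrm2_le; apply: bsum_le (lexx _) (nrm2P Hw) => j.
  rewrite ler_wpM2r ?wt_ge0 // /w /v; case: ifPn => jN; first by rewrite addr0.
  by rewrite uG.1 // cabs0 expr0n sqr_ge0.
have E j : zminusL c q k a p lam w j = - L1op a p v j.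
  have pt : p%:R <= t by rewrite lerDl (le_trans ler01).
  have := zminusL_galerkin j uG; rewrite /zminusL /Lop /L0op.
  rewrite (L1opD _ Ha0 (Hu _) (inH_mono pt (N2_inH Hvt))).
  rewrite /w {1 2}/v; case: ifPn => jN.
    move=> H; rewrite [LHS](_ : _ = (lam * u j - (symb c q k j * u j + L1op a p u j)) -
      L1op a p v j); last by ring.
    by rewrite H sub0r.
  have z0 : lam - symb c q k j != 0.
    rewrite -cabs_gt0; apply: lt_le_trans (sep j jN).
    by rewrite mulr_gt0 ?divr_gt0 // exprn_gt0 ?jb_gt0.
  move=> H; rewrite [LHS](_ : _ = (lam * u j - (symb c q k j * u j + L1op a p u j)) +
    (L1op a p u j / (lam - symb c q k j) * (lam - symb c q k j)) - L1op a p v j); last by ring.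
  by rewrite H divfK // addNr add0r.
exists w; split => //.
  exists j0; rewrite /w /v; case: ifPn => jN; first by rewrite addr0.
  by move: u0; rewrite uG.1 ?eqxx.
have HLv := HC.2 _ _ Hvt.
apply: (@N2_le _ _ _ (1 * (C * (4 / ga ^+ 2 * 2 `^ (2 * (k%:R - p%:R)) *
    P N (p%:R - k%:R) * (C * nrm2 t u))))).
  rewrite mul1r [leRHS](_ : _ = C * (4 / ga ^+ 2 * 2 `^ (2 * (k%:R - p%:R)) *
    P N (p%:R - k%:R) * (C * nrm2 s w))); last by rewrite /P; ring.
  rewrite ler_wpM2l // ler_wpM2l //; first by rewrite mulr_ge0 ?powR_ge0 // mulr_ge0 ?powR_ge0.
  apply: ler_wpM2l => //.
  exact: le_trans (nrm2_ts (Hu s)) uw.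
apply: N2_dom ler01 _ HLv => j; rewrite mul1r E cabsN.
by rewrite ler_wpM2l ?sqr_ge0 // wt_mono.
Qed.

(* High eigenvalues: the low frequencies of u are negligible, since
   |lam - symb| is of order N^k there. *)
Lemma quasimode_high Cs kap N lam u :
  (forall j, cabs (symb c q k j) <= Cs * jb j ^+ k) -> 0 <= Cs ->
  0 < kap <= 1 -> Cs * kap <= c0 / 2 -> (0 < N)%N ->
  4 / c0 ^+ 2 * C <= N%:R / 2 -> galerkin N lam u -> (exists j, u j != 0) ->
  c0 * N%:R ^+ k <= cabs lam ->
  quasimode s N lam (2 `^ (2 * (rho - r)) * C * (2 * kap `^ (2 * (t - s)))).
Proof.
move=> HCs Cs0 /andP[kap0 kap1] Ckap N0 NC uG u0 lamN.
have Hu e : inH e u by exact: inH_PN uG.1.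
have Npos : 0 < N%:R :> R by rewrite ltr0n.
have kN0 : 0 < kap * N%:R by rewrite mulr_gt0.
apply: (fun P Q => quasimode_galerkin P Q uG u0) => //; first by rewrite mulr_ge0 ?powR_ge0.
have HL : N2 rho (L1op a p u) (C * nrm2 t u) by apply: HC.2; exact: nrm2P.
have K0 : 0 <= 4 / c0 ^+ 2 by rewrite divr_ge0 ?sqr_ge0.
have K1 : 0 <= 4 / c0 ^+ 2 * P N (p%:R - k%:R) by rewrite mulr_ge0 ?powR_ge0.
(* Split at frequency kap N. Below it, u = (lam - L0)^(-1) L1 u with |lam - symb| at least (c0/2)
   N^k; above it, the weight of index t <= s is compared with that of index s. *)
have main : N2 t u (4 / c0 ^+ 2 * P N (p%:R - k%:R) * (C * nrm2 t u) +
    (kap * N%:R) `^ (2 * (t - s)) * nrm2 s u).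
  apply: bsum_le (lexx _) (bsumD (bsumZ K1 HL) (bsumZ (powR_ge0 _ _) (nrm2P (Hu s)))) => j /=.
  have [jN|jN] := boolP (inPN N j); last first.
    by rewrite uG.1 // cabs0 expr0n !mul0r mulr0 addr0 mulr_ge0 ?en_ge0.
  have [jk|jk] := lerP (jb j) (kap * N%:R); last first.
    apply: (@le_trans _ _ ((kap * N%:R) `^ (2 * (t - s)) * (cabs (u j) ^+ 2 * wt s j))).
      rewrite mulrCA ler_wpM2l ?sqr_ge0 // -{1}(subrK s t) wtD ler_wpM2r ?wt_ge0 //.
      by apply: (wt_tail kN0 (ltW jk)); rewrite subr_le0.
    by rewrite lerDr mulr_ge0 ?en_ge0.
  apply: ler_wpDr; first by rewrite mulr_ge0 ?powR_ge0 ?en_ge0.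
  have uL : (lam - symb c q k j) * u j = L1op a p u j.
    by have := uG.2 j; rewrite /PN jN /L0op mulrBl => <-; rewrite addrAC subrr add0r.
  have sep : c0 / 2 * N%:R ^+ k <= cabs (lam - symb c q k j).
    have : cabs (symb c q k j) <= c0 / 2 * N%:R ^+ k.
      apply: le_trans (HCs j) _.
      apply: (@le_trans _ _ (Cs * (kap * N%:R ^+ k))); last first.
        by rewrite mulrA ler_wpM2r ?exprn_ge0.
      rewrite ler_wpM2l //; apply: (@le_trans _ _ ((kap * N%:R) ^+ k)).
        by apply: lerXn2r; rewrite ?nnegrE ?jb_ge0 // ltW.
      rewrite exprMn ler_wpM2r ?exprn_ge0 // -[leRHS]expr1.
      by rewrite ler_wiXn2l // ltW.
    by have := ler_cabsB lam (symb c q k j); lra.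
  rewrite -uL cabsM exprMn /t wtD.
  have -> : 4 / c0 ^+ 2 * P N (p%:R - k%:R) *
      (cabs (lam - symb c q k j) ^+ 2 * cabs (u j) ^+ 2 * wt rho j) =
      cabs (u j) ^+ 2 * (4 / c0 ^+ 2 * P N (p%:R - k%:R) *
        cabs (lam - symb c q k j) ^+ 2 * wt rho j) by ring.
  rewrite ler_wpM2l ?sqr_ge0 // ler_wpM2r ?wt_ge0 //.
  apply: (@le_trans _ _ (P N p%:R)).
    by apply: wt_head; rewrite ?inPN_jb.
  have : (c0 / 2 * N%:R ^+ k) ^+ 2 <= cabs (lam - symb c q k j) ^+ 2.
    by apply: lerXn2r sep; rewrite nnegrE ?cabs_ge0 // mulr_ge0 ?exprn_ge0 ?divr_ge0 ?ltW.
  move=> /(ler_wpM2l K1); apply: le_trans.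
  have -> : (c0 / 2 * N%:R ^+ k) ^+ 2 = c0 ^+ 2 / 4 * P N k%:R.
    rewrite exprMn /P mulr_natl mulr2n powRDp // powR_mulrn // -expr2.
    by congr (_ * _); field.
  rewrite [leRHS](_ : _ = P N (p%:R - k%:R) * P N k%:R); last by field; rewrite gt_eqF.
  by rewrite -PD // subrK.
have := nrm2_le main.
have PN1 : P N (p%:R - k%:R) <= N%:R^-1.
  rewrite -powR_inv1 //; apply: ler_powR; first by rewrite ler1n.
  have : p%:R + 1 <= k%:R :> R by rewrite natr1 ler_nat.
  lra.
(* The low-frequency part is at most half of the left-hand side and is absorbed there, whence the
   factor 2 in the constant. *)
have half : 4 / c0 ^+ 2 * P N (p%:R - k%:R) * (C * nrm2 t u) <= nrm2 t u / 2.
  rewrite mulrA [leRHS]mulrC ler_wpM2r ?nrm2_ge0 // mulrAC.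
  apply: (@le_trans _ _ (N%:R / 2 * N%:R^-1)); last by rewrite mulrAC divff ?mul1r // gt_eqF.
  by apply: ler_pM; rewrite ?powR_ge0 // mulr_ge0.
rewrite (powRM _ (ltW kap0) (ler0n _ _)) -/(P N (t - s)).
move: (nrm2 t u) half (nrm2 s u) => X half Y.
move: (kap `^ _) (P N (t - s)) => x y; lra.
Qed.

End Thresholds.

Lemma quasimode_ge_index : exists D, 0 <= D /\ forall N lam u, (0 < N)%N ->
  galerkin N lam u -> (exists j, u j != 0) -> quasimode s N lam D.
Proof.
have [n0 Hn0] := symb_lower qk k1 ck 0.
have [Cs [Cs0 HCs]] := symb_upper c q k.
set ga := cabs (c k) / 2 in Hn0.
have ga0 : 0 < ga by rewrite divr_gt0 // cabs_gt0.
have [c0 c0E] : exists c0, c0 = ga / 2 / 2 ^+ k by eexists.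
have c00 : 0 < c0 by rewrite c0E divr_gt0 ?exprn_gt0 // divr_gt0.
(* Small enough that the symbol below frequency kap N stays under (c0/2) N^k; [Cs + 1] keeps the
   denominator positive. *)
pose kap := Num.min 1 (c0 / 2 / (Cs + 1)).
have kap01 : 0 < kap <= 1.
  by rewrite /kap lt_min ltr01 ge_min lexx /= andbT !divr_gt0 // ltr_wpDl.
have Ckap : Cs * kap <= c0 / 2.
  apply: (@le_trans _ _ ((Cs + 1) * kap)).
    by rewrite ler_wpM2r ?lerDl //; case/andP: kap01 => /ltW.
  by rewrite -ler_pdivlMl ?ltr_wpDl // mulrC /kap ge_min lexx orbT.
(* The first summand brings N/2 past the threshold of [symb_lower], the second permits the
   absorption in [quasimode_high]. *)
pose N0 := (2 * n0 + (Num.truncn (2 * (4 / c0 ^+ 2 * C))).+1)%N.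
pose D1 := C * P N0 (k%:R - p%:R).
pose D2 := C * (4 / ga ^+ 2 * 2 `^ (2 * (k%:R - p%:R)) * C).
pose D3 := 2 `^ (2 * (rho - r)) * C * (2 * kap `^ (2 * (t - s))).
have D10 : 0 <= D1 by rewrite mulr_ge0 ?powR_ge0.
have D20 : 0 <= D2 by rewrite !mulr_ge0 ?powR_ge0 ?invr_ge0 ?sqr_ge0.
have D30 : 0 <= D3 by rewrite !mulr_ge0 ?powR_ge0.
exists (D1 + D2 + D3); split; first by rewrite !addr_ge0.
move=> N lam u Npos uG u0.
have [NN0|/ltnW N0N] := leqP N N0.
  apply: (@quasimode_le _ _ _ D1); first lra.
  by apply: quasimode_small_N uG u0; rewrite Npos.
have [lamN|lamN] := ltP (cabs lam) (c0 * N%:R ^+ k).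
  apply: (@quasimode_le _ _ _ D2); first lra.
  by apply: (quasimode_low ga0 c0E Hn0 Npos _ uG u0 lamN); apply: leq_trans N0N; rewrite leq_addr.
apply: (@quasimode_le _ _ _ D3); first lra.
apply: (quasimode_high c00 HCs Cs0 kap01 Ckap Npos _ uG u0 lamN).
rewrite ler_pdivlMr // mulrC; apply: le_trans (ltW (truncnS_gt _)) _.
by rewrite ler_nat; apply: leq_trans N0N; rewrite leq_addl.
Qed.

End HighIndex.
End FixedIndex.
End PseudospectrumBound.

(** * Regularity of the coefficients forced by the mapping property of L *)

Section CoefficientRegularity.
Variable R : realType.
Implicit Types (u v : seqZ R) (s r : R).

Lemma jb_mul (i j : int) : jb (i + j) <= 2 * jb i * jb j :> R.
Proof.
apply: le_trans (jb_addl _ _ _) _.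
by have := jb_ge1 R i; have := jb_ge1 R j; nra.
Qed.

Lemma inH_shift r u (m : int) : 0 <= r -> inH r u -> inH r (fun j => u (j + m)).
Proof.
move=> r0 /inHP[B uB]; have r2 : 0 <= 2 * r by rewrite mulr_ge0.
apply/inHP; exists ((2 * jb (- m)) `^ (2 * r) * B).
apply: bsum_le (lexx _) (bsumZ (powR_ge0 _ _) (bsum_shift m uB)) => j /=.
rewrite mulrCA ler_wpM2l ?sqr_ge0 // /wt -/(jb j) -/(jb (j + m)) -powRM ?mulr_ge0 ?jb_ge0 //.
apply: ge0_ler_powR => //; rewrite ?nnegrE ?mulr_ge0 ?jb_ge0 //.
by have := jb_mul (- m) (j + m); rewrite addrC addrK.
Qed.

Lemma inH_sum (I : Type) (S : seq I) (F : I -> seqZ R) s : (forall x, inH s (F x)) ->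
  inH s (fun j => \sum_(x <- S) F x j).
Proof.
move=> HF; elim: S => [|x S IH].
  by under eq_fun do rewrite big_nil; exact: N2_inH (@N2_0 R s).
by under eq_fun do rewrite big_cons; exact: inHD (HF x) IH.
Qed.

Variables (c : nat -> R[i]) (q k p : nat) (a : nat -> seqZ R).

(* Applying the operator to e_0, ..., e_p and shifting back gives the combinations
   sum_d (i m)^d a_d, from which the a_d are recovered by a Vandermonde inversion. *)
Lemma coefficients_inH s r z : 0 <= r ->
  (forall u, inH s u -> inH r (zminusL c q k a p z u)) ->
  forall d, (d <= p)%N -> inH r (a d).
Proof.
move=> r0 HT d dp.
pose e (m : int) : seqZ R := fun j => (j == m)%:R.
have eS m j : j \notin [:: m] -> e m j = 0 by rewrite inE /e => /negbTE ->.
have eH t m : inH t (e m) by apply: inH_finite (eS m).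
have LE m n : L1op a p (e m) n = \sum_(0 <= d < p.+1) a d (n - m) * ('i * m%:~R) ^+ d.
  by rewrite (L1op_finite _ _ _ _ (eS m)) // big_seq1 /e eqxx mulr1.
have HL m : inH r (L1op a p (e m)).
  (* Since e_m is an eigenvector of L0, the terms in [z] and L0 are multiples of e_m and lie in
     every Sobolev space. *)
  have -> : L1op a p (e m) = fun j => (z * e m j + (-1) * (symb c q k m * e m j)) +
      (-1) * zminusL c q k a p z (e m) j.
    apply/funext => j; rewrite /zminusL /Lop /L0op.
    have -> : symb c q k j * e m j = symb c q k m * e m j.
      by rewrite /e; case: eqP => [->|_] //; rewrite !mulr0.
    by ring.
  by apply: inHD; [apply: inHD; [exact: inHZ|apply: inHZ; exact: inHZ]|
                   apply: inHZ; exact: HT].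
pose x : 'rV[R[i]]_p.+1 := \row_m ('i * (m%:Z)%:~R).
pose V := Vandermonde p.+1 x.
have Vu : V \in unitmx.
  rewrite unitmxE det_Vandermonde unitfE prodf_seq_neq0; apply/allP => i1 _ /=.
  rewrite prodf_seq_neq0; apply/allP => i2 _ /=; apply/implyP => i12.
  rewrite !mxE -mulrBr mulf_neq0 //.
    by rewrite -cabs_gt0 cabs_i.
  rewrite subr_eq0 eqr_int; move: i12; rewrite ltn_neqAle eq_sym => /andP[+ _].
  by apply: contra => /eqP[->].
pose W := invmx V.
have VW : V *m W = 1%:M by rewrite mulmxV.
pose d' : 'I_p.+1 := Ordinal (dp : (d < p.+1)%N).
(* The nodes i m are distinct, so column [d'] of the inverse Vandermonde matrix isolates a_d; the
   shift by m undoes the translation caused by e_m. *)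
have -> : a d = fun j => \sum_(m < p.+1) W m d' * L1op a p (e m%:Z) (j + m%:Z).
  apply/funext => j.
  under eq_bigr => m _ do rewrite LE addrK big_mkord mulr_sumr.
  rewrite exchange_big /=.
  transitivity (\sum_(d0 < p.+1) a d0 j * (1%:M : 'M[R[i]]_p.+1) d0 d').
    rewrite (bigD1 d') //= big1 ?addr0 => [|d0 dd0]; rewrite mxE ?eqxx ?mulr1 //.
    by rewrite (negbTE dd0) mulr0.
  apply: eq_bigr => d0 _; rewrite -VW mxE mulr_sumr; apply: eq_bigr => m _.
  by rewrite !mxE; ring.
by apply: inH_sum => m; apply: inHZ; apply: inH_shift.
Qed.

End CoefficientRegularity.

(** * Galerkin eigenvalues lie in the pseudospectrum *)

Section PartOne.
Variable R : realType.
Variables (cst : R -> R) (c : nat -> R[i]) (q k p : nat) (a : nat -> seqZ R).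
Hypotheses (cst0 : forall x, 0 < cst x).

(** Every admissible pair [M], [G] in [inv_norm] is tested on the quasimode; [D + 1] avoids a zero
    denominator when D = 0. *)
Lemma inv_norm_ge s N lam D : (0 < N)%N -> 0 <= D -> quasimode c q k p a s N lam D ->
  ((Num.sqrt (cst `|s| / (cst `|s - k%:R| * (D + 1))) * N%:R `^ (k%:R - p%:R))%:E <=
   inv_norm cst s (s - k%:R) (zminusL c q k a p lam))%E.
Proof.
move=> N0 D0 [w [Hw [j wj] HT]].
apply: le_ereal_inf_tmp => _ [M [M0 [G [G1 [G2 G3]]]] <-].
have [Tw GTw] := G1 w Hw.
have := G3 _ Tw; rewrite GTw !snorm2E // lee_fin => H.
have n0 := nrm2_gt0 Hw wj.
set P := N%:R `^ (k%:R - p%:R).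
have N0' : 0 < N%:R :> R by rewrite ltr0n.
have P0 : 0 < P by rewrite powR_gt0.
have E : N%:R `^ (2 * (p%:R - k%:R)) = (P ^+ 2)^-1.
  by rewrite mulr_natl mulr2n powRDp // expr2 invfM -!powRN opprB.
rewrite lee_fin -(ler_sqr _ M0) ?nnegrE ?mulr_ge0 ?sqrtr_ge0 ?(ltW P0) //.
have cD : 0 < cst `|s - k%:R| * (D + 1) by rewrite mulr_gt0 // ltr_wpDl.
rewrite exprMn sqr_sqrtr ?divr_ge0 ?(ltW cD) ?(ltW (cst0 _)) // mulrAC ler_pdivrMr //.
rewrite -ler_pdivlMr ?exprn_gt0 //.
rewrite -(ler_pM2r n0); apply: le_trans H _.
have HN := nrm2_le HT; rewrite E in HN.
have c1 := cst0 `|s - k%:R|.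
apply: (@le_trans _ _ (M ^+ 2 * (cst `|s - k%:R| * (D * (P ^+ 2)^-1 * nrm2 s w)))).
  by rewrite ler_wpM2l ?sqr_ge0 // ler_wpM2l // ltW.
rewrite [leRHS](_ : _ = M ^+ 2 * (cst `|s - k%:R| * ((D + 1) * (P ^+ 2)^-1 * nrm2 s w)));
  last by ring.
rewrite ler_wpM2l ?sqr_ge0 // ler_wpM2l ?(ltW c1) // ler_wpM2r ?(ltW n0) //.
by rewrite ler_wpM2r ?invr_ge0 ?sqr_ge0 // lerDl.
Qed.

Lemma pseudospec_of_inv_norm s eps lam :
  ((eps^-1)%:E < inv_norm cst s (s - k%:R) (zminusL c q k a p lam))%E ->
  pseudospec cst c q k a p s eps lam.
Proof. by move=> H e e0; exists lam; split => //; rewrite subrr cabs0. Qed.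

Hypotheses (k1 : (1 <= k)%N) (pk : (p < k)%N) (qk : (q <= k)%N) (ck : c k != 0).

Lemma pseudospec_of_quasimodes s D : 0 <= D ->
  (forall N lam u, (0 < N)%N -> galerkin c q k p a N lam u -> (exists j, u j != 0) ->
     quasimode c q k p a s N lam D) ->
  exists cc : R, forall eps : R, 0 < eps ->
    forall N : nat, (0 < N)%N -> cc * eps `^ (1 / (p%:R - k%:R)) < N%:R ->
      forall lam, fin_eig c q k a p N lam -> pseudospec cst c q k a p s eps lam.
Proof.
move=> D0 H; set K := Num.sqrt (cst `|s| / (cst `|s - k%:R| * (D + 1))).
have K0 : 0 < K.
  rewrite sqrtr_gt0 divr_gt0 ?cst0 // mulr_gt0 ?cst0 //.
  by rewrite ltr_wpDl.
(* With this constant the condition on N reads (K eps)^(1/(p-k)) < N; raising it to the power k - p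
   gives 1/eps < K N^(k-p). *)
exists (K `^ (1 / (p%:R - k%:R))) => eps eps0 N N0 KN lam [u [uN [u0 uE]]].
apply: pseudospec_of_inv_norm.
apply: lt_le_trans (inv_norm_ge N0 D0 (H N lam u N0 (conj uN uE) u0)).
rewrite -/K lte_fin.
have kp : 0 < k%:R - p%:R :> R by rewrite subr_gt0 ltr_nat.
move: KN; rewrite -powRM ?(ltW K0) ?(ltW eps0) // => KN.
have : ((K * eps) `^ (1 / (p%:R - k%:R))) `^ (k%:R - p%:R) < N%:R `^ (k%:R - p%:R).
  by apply: gt0_ltr_powR; rewrite ?nnegrE ?powR_ge0.
rewrite -powRrM (_ : 1 / (p%:R - k%:R) * (k%:R - p%:R) = -1); last first.
  by rewrite -opprB; field; rewrite gt_eqF.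
rewrite powR_inv1 ?mulr_ge0 ?(ltW K0) ?(ltW eps0) // invfM.
by rewrite ltr_pdivrMl.
Qed.

Lemma eigenvalues_in_pseudospec (l : nat) s : (1 <= l)%N ->
  (forall d, (d <= p)%N -> inH l%:R (a d)) ->
  exists cc : R, forall eps : R, 0 < eps ->
    forall N : nat, (0 < N)%N -> cc * eps `^ (1 / (p%:R - k%:R)) < N%:R ->
      forall lam, fin_eig c q k a p N lam -> pseudospec cst c q k a p s eps lam.
Proof.
move=> l1 Ha.
have l1R : 1 <= l%:R :> R by rewrite ler1n.
have Ha0 d : (d <= p)%N -> inH 0 (a d).
  by move=> /Ha; apply: inH_mono; rewrite ler0n.
have pkR : p%:R <= k%:R :> R by rewrite ler_nat ltnW.
(* If s <= p + l, the choice rho = l works with t = p + l. *)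
have [sl|sl] := lerP s (p%:R + l%:R).
  have [C HC] := L1_bounded_ge1 l1R Ha.
  apply: pseudospec_of_quasimodes; last first.
    move=> N lam u N0 uG u0; apply: (quasimode_le_index HC _ sl N0 uG u0).
    lra.
  by rewrite mulr1 mulr_ge0 ?powR_ge0 //; exact: HC.1.
pose rho := Num.max l%:R (s - k%:R).
have lr : l%:R <= rho by rewrite le_max lexx.
have srho : s - k%:R <= rho by rewrite le_max lexx orbT.
have [Har|/existsNP[d /not_implyP[dp Had]]] :=
    pselect (forall d, (d <= p)%N -> inH rho (a d)).
  have rho1 := le_trans l1R lr.
  have [C HC] := L1_bounded_ge1 rho1 Har.
  have [|D [D0 HD]] := quasimode_ge_index k1 pk qk ck rho1 HC Ha0 srho.
    by rewrite -lerBrDl ge_max; apply/andP; split; lra.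
  exact: pseudospec_of_quasimodes D0 HD.
(* Some coefficient is not in H^rho, which forces rho = s - k. Then no inverse is admissible, since
   L does not map H^s into H^(s-k): the infimum runs over the empty set and is infinite for every
   [lam]. *)
exists 0 => eps eps0 N N0 _ lam _; apply: pseudospec_of_inv_norm.
rewrite [inv_norm _ _ _ _](_ : _ = +oo%E) ?ltry //.
rewrite /inv_norm (_ : [set M%:E | M in _] = set0) ?ereal_inf0 //.
apply/seteqP; split => // x [M [_ [G [G1 _]]] _]; case: Had.
move: lr srho; rewrite /rho; case: (leP l%:R (s - k%:R)) => lsk _ _; last exact: Ha.
apply: (@coefficients_inH _ c q k p a s (s - k%:R) lam _ _ d dp).
  by apply: le_trans lsk; rewrite ler0n.
by move=> u /G1[].
Qed.

End PartOne.

(** * The maximum modulus principle for rational functions *)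

Section MaximumModulus.
Variable R : realType.
Implicit Types (P Q X : {poly R[i]}) (z w : R[i]).

Lemma horner_bounded P (r : R) : exists B, 0 <= B /\
  forall z, cabs z <= r -> cabs P.[z] <= B.
Proof.
elim/poly_ind: P => [|P e [B [B0 HB]]].
  by exists 0; split => // z _; rewrite horner0 cabs0.
exists (B * `|r| + cabs e); split; first by rewrite addr_ge0 ?mulr_ge0 ?cabs_ge0.
move=> z zr; rewrite hornerMXaddC; apply: le_trans (ler_cabsD _ _) _.
rewrite lerD2r cabsM ler_pM ?cabs_ge0 ?HB //.
exact: le_trans zr (ler_norm r).
Qed.

Lemma horner_lipschitz P z0 : exists B, 0 <= B /\
  forall z, cabs (z - z0) <= 1 -> cabs (P.[z] - P.[z0]) <= B * cabs (z - z0).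
Proof.
have /factor_theorem[Q PQ] : root (P - P.[z0]%:P) z0.
  by rewrite /root hornerD hornerN hornerC subrr.
have [B [B0 HB]] := horner_bounded Q (1 + cabs z0).
exists B; split => // z zz0.
have -> : P.[z] - P.[z0] = Q.[z] * (z - z0).
  by have := congr1 (fun q => q.[z]) PQ; rewrite hornerD hornerN hornerC hornerM hornerXsubC.
rewrite cabsM ler_wpM2r ?cabs_ge0 // HB //.
by rewrite -[z in cabs z](subrK z0) (le_trans (ler_cabsD _ _)) // lerD2r.
Qed.

(* d'Alembert's argument: q/X = w + (z - z0)^m g(z) near z0 with g(z0) != 0, and z0 can
   be left in a direction where the second term is a positive multiple of w. *)
Lemma no_interior_maximum Q X z0 w (e : R) : 0 < e -> X.[z0] != 0 -> w != 0 ->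
  Q.[z0] = w * X.[z0] -> Q - w *: X != 0 ->
  exists z, cabs (z - z0) < e /\ cabs w * cabs X.[z] < cabs Q.[z].
Proof.
move=> e0 X0 w0 Q0 QX.
have rt : root (Q - w *: X) z0 by rewrite /root hornerD hornerN hornerZ Q0 subrr.
have [m [r]] := multiplicity_XsubC (Q - w *: X) z0.
rewrite QX /= => r0 QXE.
have m0 : (0 < m)%N.
  by case: m QXE => // QXE; move: r0; rewrite -[r]mulr1 -[1](expr0 ('X - z0%:P)) -QXE rt.
rewrite rootE in r0.
(* An m-th root [eta] of [y] is the direction sought: along z0 + t eta the increment t^m y r(z0)
   equals t^m w X(z0). *)
pose y := w * X.[z0] / r.[z0].
pose eta := m.-root y.
have etaE : eta ^+ m = y by rewrite rootCK.
(* Up to the factor r(z0) X(z0), this is the difference of r/r(z0) and X/X(z0), the error made by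
   freezing r and X at z0. *)
pose d := X.[z0] *: r - r.[z0] *: X.
have d0 : d.[z0] = 0 by rewrite hornerD hornerN !hornerZ mulrC subrr.
have [B [B0 HB]] := horner_lipschitz d z0.
have [D [D0 HD]] := horner_lipschitz X z0.
have x0 : 0 < cabs X.[z0] by rewrite cabs_gt0.
have r0' : 0 < cabs r.[z0] by rewrite cabs_gt0.
(* The four bounds keep z within [e], within the range of the Lipschitz estimates, |X| above half
   its value at z0, and the error [d] at most a quarter of |r(z0) X(z0)|; the gain 1/2 then beats
   the loss 1/4. *)
pose s := Num.min (Num.min (e / 2) 1)
  (Num.min (cabs X.[z0] / 2 / (D + 1)) (cabs r.[z0] * cabs X.[z0] / 4 / (B + 1))).
have s0 : 0 < s.
  by rewrite !lt_min ltr01 !divr_gt0 ?mulr_gt0 ?ltr_wpDl.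
have h0 : 0 < cabs eta + 1 by rewrite ltr_wpDl ?cabs_ge0.
pose t := s / (cabs eta + 1).
have t0 : 0 < t by rewrite divr_gt0.
pose z := z0 + t%:C * eta.
have zs : cabs (z - z0) <= s.
  rewrite /z addrC addKr cabsM cabs_real ger0_norm ?(ltW t0) // ltW //.
  by rewrite /t mulrAC ltr_pdivrMr // ltr_pM2l // ltrDl.
exists z; split.
  apply: le_lt_trans zs _; apply: (@le_lt_trans _ _ (e / 2)).
    by rewrite !ge_min lexx.
  by rewrite ltr_pdivrMr // mulr_natr mulr2n ltrDl.
have zs1 : cabs (z - z0) <= 1 by apply: le_trans zs _; rewrite !ge_min lexx orbT.
have sD : s * (D + 1) <= cabs X.[z0] / 2.
  by rewrite -ler_pdivlMr ?ltr_wpDl // !ge_min lexx !orbT.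
have sB : s * (B + 1) <= cabs r.[z0] * cabs X.[z0] / 4.
  by rewrite -ler_pdivlMr ?ltr_wpDl // !ge_min lexx !orbT.
have Xz : cabs X.[z0] / 2 <= cabs X.[z].
  have := HD z zs1; have := ler_cabsB X.[z0] X.[z]; rewrite (cabs_distC X.[z0]).
  by have := cabs_ge0 (z - z0); nra.
have dz : cabs d.[z] <= cabs r.[z0] * cabs X.[z0] / 4.
  have := HB z zs1; rewrite d0 subr0.
  by have := cabs_ge0 (z - z0); nra.
have QzE : Q.[z] = w * ((1 + t%:C ^+ m) * X.[z] - (- (t%:C ^+ m * (d.[z] / r.[z0])))).
  have := congr1 (fun q => q.[z]) QXE.
  rewrite hornerD hornerN hornerZ hornerM horner_exp hornerXsubC => /eqP.
  rewrite subr_eq => /eqP ->.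
  rewrite (_ : z - z0 = t%:C * eta); last by rewrite /z addrC addKr.
  rewrite exprMn etaE /y.
  rewrite hornerD hornerN !hornerZ; field.
  exact: r0.
rewrite QzE cabsM ltr_pM2l ?cabs_gt0 //.
apply: lt_le_trans (ler_cabsB _ _).
have tm : 0 < t ^+ m by rewrite exprn_gt0.
have -> : 1 + t%:C ^+ m = (1 + t ^+ m)%:C by rewrite rmorphD rmorphXn rmorph1.
rewrite cabsN !cabsM cabs_real cabsX cabs_real cabsV.
rewrite !ger0_norm ?addr_ge0 ?exprn_ge0 ?(ltW t0) //.
have dr : cabs d.[z] / cabs r.[z0] <= cabs X.[z0] / 4.
  by rewrite ler_pdivrMr // mulrC mulrA.
nra.
Qed.

(** Both parts are handled in one induction because multiplication by the variable mixes them. *)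
Lemma continuous_horner_Re_Im P :
  continuous (fun xy : R * R => complex.Re P.[xy.1 +i* xy.2]) /\
  continuous (fun xy : R * R => complex.Im P.[xy.1 +i* xy.2]).
Proof.
elim/poly_ind: P => [|P e [cR cI]].
  by split; under eq_fun do rewrite horner0; move=> xy; exact: cvg_cst.
have cx : continuous (fun xy : R * R => xy.1) by move=> xy; exact: cvg_fst.
have cy : continuous (fun xy : R * R => xy.2) by move=> xy; exact: cvg_snd.
split=> xy.
- have E (v : R * R) : complex.Re (P * 'X + e%:P).[v.1 +i* v.2] =
      complex.Re P.[v.1 +i* v.2] * v.1 - complex.Im P.[v.1 +i* v.2] * v.2 + complex.Re e.
    by rewrite hornerMXaddC; case: (P.[_]) e => ? ? [].
  rewrite (funext E); apply: cvgD; last exact: cvg_cst.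
  by apply: cvgB; apply: cvgM; [exact: cR|exact: cx|exact: cI|exact: cy].
- have E (v : R * R) : complex.Im (P * 'X + e%:P).[v.1 +i* v.2] =
      complex.Re P.[v.1 +i* v.2] * v.2 + complex.Im P.[v.1 +i* v.2] * v.1 + complex.Im e.
    by rewrite hornerMXaddC; case: (P.[_]) e => ? ? [].
  rewrite (funext E); apply: cvgD; last exact: cvg_cst.
  by apply: cvgD; apply: cvgM; [exact: cR|exact: cy|exact: cI|exact: cx].
Qed.

Lemma continuous_horner_sq P : continuous (fun xy : R * R => cabs P.[xy.1 +i* xy.2] ^+ 2).
Proof.
have [cR cI] := continuous_horner_Re_Im P; move=> xy.
have E (v : R * R) : cabs P.[v.1 +i* v.2] ^+ 2 =
    complex.Re P.[v.1 +i* v.2] * complex.Re P.[v.1 +i* v.2] +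
    complex.Im P.[v.1 +i* v.2] * complex.Im P.[v.1 +i* v.2].
  by rewrite cabs_sqE !expr2.
rewrite (funext E).
by apply: cvgD; apply: cvgM; [exact: cR|exact: cR|exact: cI|exact: cI].
Qed.

(** The quotient |Q/X| attains its maximum on the closed disc. A maximum above [K] would be
    interior, so Q/X would be a constant [w], which contradicts the bound on the circle. *)
Lemma maximum_modulus Q X z0 (de K : R) : 0 < de ->
  (forall z, cabs (z - z0) <= de -> X.[z] != 0) ->
  (forall z, cabs (z - z0) = de -> cabs Q.[z] <= K * cabs X.[z]) ->
  cabs Q.[z0] <= K * cabs X.[z0].
Proof.
move=> de0 Xn0 QK; rewrite leNgt; apply/negP => Qz0.
have zb : cabs (z0 + de%:C - z0) = de by rewrite addrC addKr cabs_real ger0_norm ?ltW.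
have Xb : 0 < cabs X.[z0 + de%:C] by rewrite cabs_gt0 Xn0 // zb.
have K0 : 0 <= K.
  by rewrite -(pmulr_lge0 _ Xb) (le_trans (cabs_ge0 _) (QK _ zb)).
pose A := [set xy : R * R | cabs (xy.1 +i* xy.2 - z0) ^+ 2 <= de ^+ 2].
have AP (xy : R * R) : A xy <-> cabs (xy.1 +i* xy.2 - z0) <= de.
  by rewrite /A /= ler_sqr ?nnegrE ?cabs_ge0 // ltW.
have cA : compact A.
  (* The disc is a closed subset of this compact square. *)
  pose B : set (R * R) := [set x | x \in `[complex.Re z0 - de, complex.Re z0 + de]] `*`
            [set y | y \in `[complex.Im z0 - de, complex.Im z0 + de]].
  apply: (@subclosed_compact _ A B).
  - have c1 := @continuous_horner_sq ('X - z0%:P).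
    rewrite (_ : A = (fun xy : R * R => cabs ('X - z0%:P).[xy.1 +i* xy.2] ^+ 2) @^-1`
        [set x | x <= de ^+ 2]); last first.
      by apply/funext => xy; rewrite /A /= hornerXsubC.
    by apply: (closed_comp _ (@closed_le _ _)) => // xy _; exact: c1.
  - by apply: compact_setX; exact: segment_compact.
  - move=> [x y] /AP H; rewrite /B /=; split; rewrite /= in_itv /= -ler_distlC distrC.
      by apply: le_trans H; have := Re_cabs (x +i* y - z0); case: (z0).
    by apply: le_trans H; have := Im_cabs (x +i* y - z0); case: (z0).
(* Squared moduli are polynomials in the two real coordinates, which gives continuity directly. *)
pose f (xy : R * R) := cabs Q.[xy.1 +i* xy.2] ^+ 2 / cabs X.[xy.1 +i* xy.2] ^+ 2.
have cf : {within A, continuous f}.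
  apply: continuous_in_subspaceT => xy /set_mem /AP xyA.
  apply: cvgM; first exact: continuous_horner_sq.
  apply: cvgV; last exact: continuous_horner_sq.
  by rewrite expf_neq0 // cabs_eq0 Xn0.
have A0 : A !=set0.
  exists (complex.Re z0, complex.Im z0); apply/AP => /=.
  by case: z0 {Xn0 QK Qz0 zb Xb A AP cA cf f} => ? ? /=; rewrite subrr cabs0 ltW.
have [[x1 y1] /set_mem /AP /= xyA fmax] := compact_EVT_max A0 cA cf.
set z1 := x1 +i* y1 in xyA.
have fle z : cabs (z - z0) <= de -> cabs Q.[z] * cabs X.[z1] <= cabs Q.[z1] * cabs X.[z].
  move=> zde; have /fmax : (complex.Re z, complex.Im z) \in A.
    by apply/mem_set/AP; case: z zde.
  have zE : (complex.Re z +i* complex.Im z) = z by case: z {zde}.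
  rewrite /f /= zE -/z1.
  have X1 : 0 < cabs X.[z1] by rewrite cabs_gt0 Xn0.
  have X2 : 0 < cabs X.[z] by rewrite cabs_gt0 Xn0.
  rewrite -!expr_div_n ler_sqr ?nnegrE ?divr_ge0 ?cabs_ge0 //.
  by rewrite ler_pdivrMr // mulrAC ler_pdivlMr.
have X1 : X.[z1] != 0 by rewrite Xn0.
pose w := Q.[z1] / X.[z1].
have QwX : Q.[z1] = w * X.[z1] by rewrite divfK.
have wK : K < cabs w.
  have z00 : cabs (z0 - z0) <= de by rewrite subrr cabs0 ltW.
  have X0 : 0 < cabs X.[z0] by rewrite cabs_gt0 Xn0.
  have := fle z0 z00; rewrite QwX cabsM mulrAC ler_pM2r ?cabs_gt0 // => H.
  by rewrite -(ltr_pM2r X0); apply: lt_le_trans Qz0 H.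
have w0 : w != 0 by rewrite -cabs_gt0 (le_lt_trans K0).
have z1de : cabs (z1 - z0) < de.
  rewrite lt_neqAle xyA andbT; apply/eqP => /QK.
  by rewrite QwX cabsM ler_pM2r ?cabs_gt0 // leNgt wK.
have [QX|QX] := eqVneq (Q - w *: X) 0.
  move/eqP: QX; rewrite subr_eq0 => /eqP QX.
  by have := QK _ zb; rewrite QX hornerZ cabsM ler_pM2r // leNgt wK.
have e0 : 0 < de - cabs (z1 - z0) by rewrite subr_gt0.
have [z [zz1 Qz]] := no_interior_maximum e0 X1 w0 QwX QX.
have zde : cabs (z - z0) <= de.
  have -> : z - z0 = (z - z1) + (z1 - z0) by ring.
  by apply: le_trans (ler_cabsD _ _) _; lra.
have := fle z zde; rewrite QwX cabsM mulrAC ler_pM2r ?cabs_gt0 //.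
by rewrite leNgt Qz.
Qed.

End MaximumModulus.

(** * The maximum principle for solutions of a linear system with a parameter *)

Section ResolventMaximum.
Variables (R : realType) (n : nat) (A : 'M[R[i]]_n).

Definition sq (x : 'cV[R[i]]_n) : R := \sum_(h < n) cabs (x h 0) ^+ 2.

Lemma sq_ge0 x : 0 <= sq x.
Proof. by apply: sumr_ge0 => h _; exact: sqr_ge0. Qed.

Lemma map_char_poly_mx_eval (z : R[i]) :
  map_mx (horner_eval z) (char_poly_mx A) = z%:M - A.
Proof.
apply/matrixP => h h'; rewrite !mxE /horner_eval hornerD hornerN hornerC.
by rewrite hornerMn hornerX.
Qed.

(* By Cramer's rule the solutions x(z) of (z - A) x(z) = g are rational functions of z,
   to which the maximum principle applies after pairing with x(z0). *)
Lemma resolvent_maximum (g y : 'cV[R[i]]_n) (z0 : R[i]) (de K : R) : 0 < de ->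
  (forall z, cabs (z - z0) <= de -> \det (z%:M - A) != 0) ->
  (forall z x, cabs (z - z0) = de -> (z%:M - A) *m x = g -> sq x <= K) ->
  (z0%:M - A) *m y = g -> sq y <= K.
Proof.
move=> de0 nz HK yg.
pose X := \det (char_poly_mx A).
have XE z : X.[z] = \det (z%:M - A).
  by rewrite -map_char_poly_mx_eval det_map_mx.
pose V := \adj (char_poly_mx A) *m map_mx polyC g.
pose ev z := map_mx (horner_eval z) V.
have evE z : (z%:M - A) *m ev z = X.[z] *: g.
  rewrite -map_char_poly_mx_eval /ev -map_mxM /V mulmxA mul_mx_adj mul_scalar_mx.
  by apply/matrixP => h h'; rewrite !mxE /= /horner_eval hornerM hornerC.
pose Q := \sum_(h < n) (conjc (y h 0))%:P * V h 0.
have QE z : Q.[z] = \sum_(h < n) conjc (y h 0) * ev z h 0.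
  rewrite /Q horner_sum; apply: eq_bigr => h _.
  by rewrite hornerM hornerC /ev [in RHS]mxE.
have cc (w : R[i]) : cabs (conjc w) = cabs w.
  by case: w => r s; rewrite /cabs /= sqrrN.
have cw (w : R[i]) : conjc w * w = (cabs w ^+ 2)%:C.
  rewrite cabs_sqE; case: w => r s; apply/eqP; rewrite eq_complex /=.
  by apply/andP; split; apply/eqP; ring.
(* On the circle the pairing is bounded through 2 x y <= x^2 + y^2. At z0 it equals [sq y], so the
   estimate reads sq y <= (sq y + K) / 2. *)
have H : cabs Q.[z0] <= (sq y + K) / 2 * cabs X.[z0].
  apply: (maximum_modulus de0) => [z zde|z zde]; first by rewrite XE nz.
  have X0 : X.[z] != 0 by rewrite XE nz // zde.
  have := HK z (X.[z]^-1 *: ev z) zde.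
  rewrite -scalemxAr evE scalerA mulVf // scale1r => /(_ erefl) xK.
  have -> : Q.[z] = X.[z] * \sum_(h < n) conjc (y h 0) * (X.[z]^-1 *: ev z) h 0.
    rewrite QE mulr_sumr; apply: eq_bigr => h _.
    by rewrite [(_ *: ev z) h 0]mxE [RHS]mulrCA mulVKf.
  rewrite cabsM mulrC ler_wpM2r ?cabs_ge0 //.
  apply: le_trans (cabs_sum _ _) _.
  apply: (@le_trans _ _ ((sq y + sq (X.[z]^-1 *: ev z)) / 2)); last first.
    by rewrite ler_pM2r ?invr_gt0 // lerD2l.
  rewrite /sq -big_split mulr_suml; apply: ler_sum => h _ /=.
  rewrite cabsM cc; have := sqr_ge0 (cabs (y h 0) - cabs ((X.[z]^-1 *: ev z) h 0)).
  by rewrite !expr2; lra.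
have z00 : cabs (z0 - z0) <= de by rewrite subrr cabs0 ltW.
have X0 : X.[z0] != 0 by rewrite XE nz.
have y0 : ev z0 = X.[z0] *: y.
  have U : z0%:M - A \in unitmx by rewrite unitmxE unitfE nz.
  by apply: (can_inj (mulKmx U)); rewrite evE -scalemxAr yg.
have QX : Q.[z0] = X.[z0] * (sq y)%:C.
  rewrite QE y0 /sq rmorph_sum mulr_sumr; apply: eq_bigr => h _ /=.
  by rewrite [(_ *: y) h 0]mxE mulrCA cw.
move: H; rewrite QX cabsM mulrC cabs_real ger0_norm ?sq_ge0 //.
by rewrite ler_pM2r ?cabs_gt0 //; lra.
Qed.

End ResolventMaximum.

(** * Approximation of an eigenvalue by Galerkin eigenvalues *)

Section PartTwo.
Variable R : realType.
Variables (cst : R -> R) (c : nat -> R[i]) (q k p : nat) (a : nat -> seqZ R) (zeta : R[i]).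
Hypotheses (cst0 : forall x, 0 < cst x).
Hypotheses (k1 : (1 <= k)%N) (pk : (p < k)%N) (qk : (q <= k)%N) (ck : c k != 0).

Section GalerkinMatrix.
Variable N : nat.
Hypothesis N0 : (0 < N)%N.
Implicit Types (x : 'cV[R[i]]_N) (u : seqZ R).

Definition idx (h : 'I_N) : int := h%:Z - (N./2)%:Z.

Definition idxs : seq int := [seq idx h | h <- enum 'I_N].

Lemma idx_inj : injective idx.
Proof. by move=> h h' /addIr [] /ord_inj. Qed.

Lemma idxs_uniq : uniq idxs.
Proof. by rewrite map_inj_uniq ?enum_uniq //; exact: idx_inj. Qed.

Lemma inPN_idx h : inPN N (idx h).
Proof. by rewrite /inPN /idx; have := ltn_ord h; lia. Qed.

Lemma inPN_idxs j : inPN N j -> exists h, j = idx h.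
Proof.
move=> /andP[j1 j2]; have jN : (absz (j + (N./2)%:Z)%R < N)%N by lia.
by exists (Ordinal jN); rewrite /idx /=; lia.
Qed.

Lemma notin_idxs j : j \notin idxs -> ~~ inPN N j.
Proof.
by apply: contra => /inPN_idxs[h ->]; rewrite map_f // mem_enum.
Qed.

(** Extension by zero off ran PN, written with indicators so that [idx] need not be inverted. *)
Definition ext (x : 'cV[R[i]]_N) : seqZ R :=
  fun j => \sum_(h < N) x h 0 * (j == idx h)%:R.

Lemma ext_idx x h : ext x (idx h) = x h 0.
Proof.
rewrite /ext (bigD1 h) //= eqxx mulr1 big1 ?addr0 // => h' hh'.
by rewrite (inj_eq idx_inj) eq_sym (negbTE hh') mulr0.
Qed.

Lemma ext_out x j : ~~ inPN N j -> ext x j = 0.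
Proof.
move=> jN; rewrite /ext big1 // => h _; case: eqP => [jh|]; last by rewrite mulr0.
by move: jN; rewrite jh inPN_idx.
Qed.

Lemma extP (x : 'cV[R[i]]_N) (u : seqZ R) : (forall h, u (idx h) = x h 0) ->
  (forall j, ~~ inPN N j -> u j = 0) ->
  u = ext x.
Proof.
move=> ui uo; apply/funext => j; have [/inPN_idxs[h ->]|jN] := boolP (inPN N j).
  by rewrite ext_idx.
by rewrite uo // ext_out.
Qed.

Lemma sum_idxs (F : int -> R[i]) : \sum_(j <- idxs) F j = \sum_(h < N) F (idx h).
Proof. by rewrite big_map big_enum. Qed.

Lemma N2_ext x : N2 0 (ext x) (sq x).
Proof.
move=> S uS; rewrite (bigID (mem idxs)) /= [X in _ + X]big1 ?addr0; last first.
  by move=> j /notin_idxs jN; rewrite ext_out // cabs0 expr0n mul0r.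
rewrite -big_filter.
apply: (@le_trans _ _ (\sum_(j <- idxs) cabs (ext x j) ^+ 2 * wt 0 j)).
  apply: ler_sum_sub; rewrite ?filter_uniq ?idxs_uniq // => j.
  by rewrite mem_filter => /andP[].
rewrite big_map big_enum; apply: ler_sum => h _.
by rewrite ext_idx wt0 mulr1.
Qed.

Lemma sq_le (u : seqZ R) (x : 'cV[R[i]]_N) B :
  (forall h, u (idx h) = x h 0) -> N2 0 u B -> sq x <= B.
Proof.
move=> ux /(_ idxs idxs_uniq); apply: le_trans; rewrite big_map big_enum.
by apply: ler_sum => h _; rewrite ux wt0 mulr1.
Qed.

Definition gal_mx : 'M[R[i]]_N := \matrix_(h, h') ((h == h')%:R * symb c q k (idx h) +
  \sum_(0 <= d < p.+1) a d (idx h - idx h') * ('i * (idx h')%:~R) ^+ d).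

Lemma gal_mxE x h :
  (gal_mx *m x) h 0 = L0op c q k (ext x) (idx h) + L1op a p (ext x) (idx h).
Proof.
rewrite (L1op_finite _ _ _ idxs_uniq); last first.
  by move=> j /notin_idxs jN; rewrite ext_out.
rewrite sum_idxs mxE /L0op ext_idx.
under [X in _ = _ + X]eq_bigr do rewrite ext_idx.
have -> : symb c q k (idx h) * x h 0 = \sum_(h' < N) (h == h')%:R * symb c q k (idx h) * x h' 0.
  rewrite (bigD1 h) //= eqxx mul1r big1 ?addr0 // => h' hh'.
  by rewrite eq_sym (negbTE hh') !mul0r.
by rewrite -big_split; apply: eq_bigr => h' _; rewrite mxE mulrDl.
Qed.

Lemma gal_resE z x h : ((z%:M - gal_mx) *m x) h 0 =
  z * x h 0 - (L0op c q k (ext x) (idx h) + L1op a p (ext x) (idx h)).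
Proof. by rewrite mulmxBl mul_scalar_mx mxE [X in X + _]mxE [X in _ + X]mxE gal_mxE. Qed.

Lemma fin_eig_det z : \det (z%:M - gal_mx) = 0 -> fin_eig c q k a p N z.
Proof.
(* [det0P] produces a row null vector, hence the transpose. *)
rewrite -det_tr => /eqP/det0P[v v0 vM].
pose x := v^T.
have xM : (z%:M - gal_mx) *m x = 0.
  by rewrite -[z%:M - _]trmxK -trmx_mul vM trmx0.
have [h xh] : exists h, x h 0 != 0.
  apply/not_existsP => H; move/eqP: v0; apply; apply/rowP => h.
  by have /negP := H h; rewrite negbK => /eqP; rewrite !mxE.
exists (ext x); split; first exact: ext_out.
split; first by exists (idx h); rewrite ext_idx.
move=> j; have [/inPN_idxs[h' ->]|jN] := boolP (inPN N j); last first.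
  by rewrite /PN (negbTE jN) /L0op ext_out // !mulr0 addr0.
have := gal_resE z x h'; rewrite xM mxE /PN inPN_idx ext_idx => /esym/eqP.
by rewrite subr_eq0 => /eqP <-.
Qed.

Variables (n0 : nat) (e1 ga C : R).
Hypotheses (e10 : 0 < e1) (ga0 : 0 < ga)
  (He1 : forall j, e1 <= cabs (symb c q k j - zeta))
  (Hn0 : forall j, n0%:R <= jb j :> R -> ga * jb j ^+ k <= cabs (symb c q k j - zeta))
  (HC : L1_bounded a p 0 C) (nN : (2 * n0 <= N)%N).

(** On frequencies of ran PN, id - K is the Galerkin residual divided by symb - zeta. Elsewhere L1
    (ext x) alone remains: L1 costs N^p and the division gains (N/2)^k. *)
Lemma idK_N2 z x : N2 0 (idK c q k a p zeta z (ext x))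
  (e1 ^- 2 * sq ((z%:M - gal_mx) *m x) +
   2 `^ (2 * k%:R) / ga ^+ 2 * C * N%:R `^ (2 * (p%:R - k%:R)) * sq x).
Proof.
have Npos : 0 < N%:R :> R by rewrite ltr0n.
have N2pos : 0 < N%:R / 2 :> R by rewrite divr_gt0.
have xp : N2 (p%:R + 0) (ext x) (N%:R `^ (2 * p%:R) * sq x).
  apply: N2_dom (N2_ext x) => [|j]; first exact: powR_ge0.
  have [jN|jN] := boolP (inPN N j); last by rewrite ext_out // cabs0 expr0n !mul0r mulr0.
  rewrite wt0 addr0 mulr1 mulrC ler_wpM2r ?sqr_ge0 //.
  by apply: wt_head; rewrite ?inPN_jb.
have HL := HC.2 _ _ xp.
have e2 : 0 <= e1 ^- 2 by rewrite invr_ge0 sqr_ge0.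
pose F := 2 `^ (2 * k%:R) / ga ^+ 2 * N%:R `^ (- (2 * k%:R)).
have F0 : 0 <= F by rewrite !mulr_ge0 ?powR_ge0 ?invr_ge0 ?sqr_ge0.
have -> : 2 `^ (2 * k%:R) / ga ^+ 2 * C * N%:R `^ (2 * (p%:R - k%:R)) * sq x =
    F * (C * (N%:R `^ (2 * p%:R) * sq x)).
  by rewrite mulrBr powRDp // /F; ring.
apply: bsum_le (lexx _) (bsumD (bsumZ e2 (N2_ext _)) (bsumZ F0 HL)) => j /=.
rewrite !wt0 !mulr1 /idK /Nop cabsM cabsV exprMn exprVn.
have sp j' : 0 < cabs (symb c q k j' - zeta) := lt_le_trans e10 (He1 j').
have [/inPN_idxs[h ->]|jN] := boolP (inPN N j).
  apply: ler_wpDr; first by rewrite mulr_ge0 ?sqr_ge0.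
  rewrite !ext_idx (_ : Lop _ _ _ _ _ _ _ - _ = - ((z%:M - gal_mx) *m x) h 0); last first.
    by rewrite gal_resE /Lop opprB.
  rewrite cabsN [leLHS]mulrC ler_wpM2r ?sqr_ge0 // lef_pV2 ?posrE ?exprn_gt0 //.
  by apply: lerXn2r; rewrite ?nnegrE ?cabs_ge0 ?(ltW e10).
apply: (@le_trans _ _ (F * cabs (L1op a p (ext x) j) ^+ 2)); last first.
  by rewrite lerDr mulr_ge0 ?sqr_ge0.
rewrite /Lop /L0op ext_out // !mulr0 add0r subr0 mulrC ler_wpM2r ?sqr_ge0 //.
have jN2 := notinPN_jb R jN.
have : ga * jb j ^+ k <= cabs (symb c q k j - zeta).
  apply: Hn0; apply: le_trans jN2.
  by rewrite ler_pdivlMr // -natrM ler_nat mulnC.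
have gj : 0 < ga * (N%:R / 2) ^+ k by rewrite mulr_gt0 ?exprn_gt0.
move=> gjs; have gs : ga * (N%:R / 2) ^+ k <= cabs (symb c q k j - zeta).
  apply: le_trans gjs; rewrite ler_pM2l //.
  by apply: lerXn2r; rewrite ?nnegrE ?jb_ge0 ?(ltW N2pos).
have -> : F = ((ga * (N%:R / 2) ^+ k) ^+ 2)^-1.
  have pw (b : R) : 0 < b -> b `^ (2 * k%:R) = (b ^+ k) ^+ 2.
    by move=> b0; rewrite mulr_natl mulr2n powRDp // powR_mulrn ?ltW // expr2.
  rewrite /F powRN !pw // expr_div_n; field.
  by rewrite !gt_eqF ?exprn_gt0.
rewrite lef_pV2 ?posrE ?exprn_gt0 //.
by apply: lerXn2r; rewrite ?nnegrE ?cabs_ge0 ?(ltW gj).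
Qed.

(* On ran PN the operator id - K differs from its Galerkin truncation by O(N^(p-k)),
   which is absorbed when the inverse is o(N^(k-p)). *)
Lemma circle_bound z x (eps : R) : 0 < eps ->
  8 * eps ^+ 2 * (2 `^ (2 * k%:R) / ga ^+ 2 * C) <= 1 ->
  (inv_norm cst 0 0 (idK c q k a p zeta z) * (N%:R `^ (p%:R - k%:R))%:E <= eps%:E)%E ->
  sq x <= 8 * eps ^+ 2 * e1 ^- 2 * N%:R `^ (2 * (k%:R - p%:R)) * sq ((z%:M - gal_mx) *m x).
Proof.
move=> eps0 epsC.
have Npos : 0 < N%:R :> R by rewrite ltr0n.
pose P : R := N%:R `^ (k%:R - p%:R).
have P0 : 0 < P by rewrite powR_gt0.
have PV : N%:R `^ (p%:R - k%:R) = P^-1 by rewrite -powRN opprB.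
have P2 : N%:R `^ (2 * (k%:R - p%:R)) = P ^+ 2 by rewrite mulr_natl mulr2n powRDp // expr2.
have P2V : N%:R `^ (2 * (p%:R - k%:R)) = (P ^+ 2)^-1.
  by rewrite mulr_natl mulr2n powRDp // PV expr2 invfM.
rewrite PV lee_pdivrMr // -EFinM => H.
(* [inv_norm] is an infimum that may not be attained, so the bound is doubled to extract an actual
   inverse. *)
have /ereal_inf_lt[_ [M [M0 [G [G1 [G2 G3]]]] <-]] :
    (inv_norm cst 0 0 (idK c q k a p zeta z) < (2 * (eps * P))%:E)%E.
  apply: le_lt_trans H _; rewrite lte_fin mulr_natl mulr2n ltrDl.
  by rewrite mulr_gt0.
rewrite lte_fin => MP.
have Hx : inH 0 (ext x) := N2_inH (N2_ext x).
have [Tx GTx] := G1 _ Hx.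
have := G3 _ Tx; rewrite GTx !snorm2E // lee_fin mulrCA ler_pM2l // => HM.
have xn : sq x <= nrm2 0 (ext x).
  by apply: sq_le (nrm2P Hx) => h; rewrite ext_idx.
have Tn := nrm2_le (idK_N2 z x).
rewrite P2V in Tn; rewrite P2.
have MM : M ^+ 2 <= 4 * eps ^+ 2 * P ^+ 2.
  rewrite [leRHS](_ : _ = (2 * (eps * P)) ^+ 2); last by ring.
  by apply: lerXn2r; rewrite ?nnegrE ?(ltW MP) ?mulr_ge0 ?(ltW eps0) ?(ltW P0).
have S0 := sq_ge0 ((z%:M - gal_mx) *m x).
have x0 := sq_ge0 x.
move: (sq ((z%:M - gal_mx) *m x)) (sq x) Tn S0 x0 xn => S X Tn S0 X0 xn.
set K2 := 2 `^ (2 * k%:R) / ga ^+ 2 * C in epsC Tn.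
have K20 : 0 <= K2 by rewrite !mulr_ge0 ?powR_ge0 ?invr_ge0 ?sqr_ge0 ?HC.1.
have e2 : 0 <= e1 ^- 2 by rewrite invr_ge0 sqr_ge0.
(* By [epsC] the term in [X] on the right is at most X/2 and moves to the left. *)
have : X <= 4 * eps ^+ 2 * P ^+ 2 * (e1 ^- 2 * S + K2 * (P ^+ 2)^-1 * X).
  apply: le_trans xn _; apply: le_trans HM _.
  apply: ler_pM => //; rewrite ?sqr_ge0 ?nrm2_ge0 //.
rewrite mulrDr (_ : 4 * eps ^+ 2 * P ^+ 2 * (K2 * (P ^+ 2)^-1 * X) = 4 * eps ^+ 2 * K2 * X);
  last by field; rewrite gt_eqF.
have : 8 * eps ^+ 2 * K2 * X <= 1 * X by rewrite ler_wpM2r.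
rewrite (_ : 4 * eps ^+ 2 * P ^+ 2 * (e1 ^- 2 * S) = 4 * eps ^+ 2 * e1 ^- 2 * P ^+ 2 * S);
  last by ring.
lra.
Qed.

End GalerkinMatrix.

Lemma eigenvalue_approximation lam (delta : nat -> R) :
  (forall d, (d <= p)%N -> inH 1 (a d)) -> (forall m : int, zeta != symb c q k m) ->
  (exists u : seqZ R, inH k%:R u /\ (exists j, u j != 0) /\
     forall j, Lop c q k a p u j = lam * u j) ->
  (forall N, 0 < delta N) ->
  small_o1 (fun N => (maxK cst c q k a p zeta lam (delta N) 0
                      * (N%:R `^ (p%:R - k%:R))%:E)%E) ->
  exists N0 : nat, forall N : nat, (N0 < N)%N ->
    exists lamN, fin_eig c q k a p N lamN /\ cabs (lam - lamN) <= delta N.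
Proof.
move=> Ha Hz [u [Hu [[j0 u0] uL]]] delta0 Ho.
have [C HC] := L1_bounded0 Ha; have C0 := HC.1.
have [e1 [e10 He1]] := symb_away qk k1 ck Hz.
have [n0 Hn0] := symb_lower qk k1 ck zeta.
set ga := cabs (c k) / 2 in Hn0.
have ga0 : 0 < ga by rewrite divr_gt0 // cabs_gt0.
pose K2 := 2 `^ (2 * k%:R) / ga ^+ 2 * C.
pose K3 := 8 * e1 ^- 2 * (C * (2 `^ (2 * (k%:R - p%:R)) * nrm2 k%:R u)).
pose U := cabs (u j0) ^+ 2.
have U0 : 0 < U by rewrite exprn_gt0 // cabs_gt0.
have K20 : 0 <= K2 by rewrite !mulr_ge0 ?powR_ge0 ?invr_ge0 ?sqr_ge0.
have K30 : 0 <= K3 by rewrite !mulr_ge0 ?powR_ge0 ?invr_ge0 ?sqr_ge0 ?nrm2_ge0.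
(* With eps^2 E < 1, both requirements are met: the smallness needed on the circle, and a final
   bound eps^2 K3 below |u_j0|^2. *)
pose E := 8 * K2 + K3 / U.
have E0 : 0 <= E.
  by apply: addr_ge0; [exact: mulr_ge0|apply: divr_ge0 => //; exact: ltW].
pose eps := (E + 1)^-1.
have E1 : 0 < E + 1 by rewrite ltr_wpDl.
have eps0 : 0 < eps by rewrite invr_gt0.
have eps1 : eps <= 1 by rewrite invf_le1 // lerDr.
have epsE : eps ^+ 2 * E < 1.
  apply: (@le_lt_trans _ _ (eps * E)).
    by rewrite ler_wpM2r // expr2 ler_piMl // ltW.
  by rewrite /eps mulrC ltr_pdivrMr // mul1r ltrDl.
have epsK2 : 8 * eps ^+ 2 * K2 <= 1.
  apply: ltW; apply: le_lt_trans epsE; rewrite mulrAC mulrC ler_wpM2l ?sqr_ge0 //.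
  by rewrite /E lerDl; apply: divr_ge0 => //; exact: ltW.
have epsK3 : eps ^+ 2 * K3 < U.
  rewrite -[ltRHS]mul1r -ltr_pdivrMr // -mulrA; apply: le_lt_trans epsE.
  by rewrite ler_wpM2l ?sqr_ge0 // /E lerDr; exact: mulr_ge0.
have [N1 HN1] := Ho eps eps0.
(* Past this rank the hypothesis gives [eps], the cut-off exceeds the threshold of the symbol, and
   j0 is a retained frequency. *)
exists (N1 + 2 * n0 + 2 * `|j0| + 2)%N => N NN.
have N0 : (0 < N)%N by clear -NN; lia.
have nN : (2 * n0 <= N)%N by clear -NN; lia.
have Npos : 0 < N%:R :> R by rewrite ltr0n.
have N2pos : 0 < N%:R / 2 :> R by rewrite divr_gt0.
have j0N : inPN N j0 by rewrite /inPN; clear -NN; lia.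
apply: contrapT => noeig.
pose A := gal_mx N.
have nz z : cabs (z - lam) <= delta N -> \det (z%:M - A) != 0.
  move=> zd; apply/eqP => /(fin_eig_det N0) ez; apply: noeig; exists z; split => //.
  by rewrite cabs_distC.
pose y : 'cV[R[i]]_N := \col_h u (idx h).
pose v j := if inPN N j then 0 else u j.
pose g : 'cV[R[i]]_N := \col_h L1op a p v (idx h).
have Hup : inH p%:R u by apply: inH_mono Hu; rewrite ler_nat ltnW.
have Hv : N2 (p%:R + 0) v ((N%:R / 2) `^ (2 * (p%:R - k%:R)) * nrm2 k%:R u).
  apply: N2_dom (nrm2P Hu) => [|j]; first exact: powR_ge0.
  rewrite /v; case: ifPn => jN; first by rewrite cabs0 expr0n mul0r mulr_ge0 ?powR_ge0 ?en_ge0.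
  rewrite addr0 mulrCA ler_wpM2l ?sqr_ge0 // -{1}(subrK k%:R p%:R) wtD ler_wpM2r ?wt_ge0 //.
  by apply: (wt_tail N2pos (notinPN_jb R jN)); rewrite subr_le0 ler_nat ltnW.
have Ha0 d : (d <= p)%N -> inH 0 (a d) by move=> /Ha; apply: inH_mono.
(* Split [u] into its truncation [ext y] and its tail [v], and read the eigenvalue equation at the
   retained frequencies. *)
have yg : (lam%:M - A) *m y = g.
  apply/colP => h; rewrite (gal_resE N0) [RHS]mxE.
  have extE : ext y = fun j => if inPN N j then u j else 0.
    apply/esym; apply: extP => // [h'|j /negbTE ->] //.
    by rewrite inPN_idx // mxE.
  have uE : u = fun j => ext y j + v j.
    by apply/funext => j; rewrite extE /v; case: ifP; rewrite ?addr0 ?add0r.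
  have Hey : inH p%:R (ext y) by apply: inH_PN (@ext_out _ N0 y).
  have Hvp : inH p%:R v by move: Hv; rewrite addr0 => /N2_inH.
  have := L1opD (idx h) Ha0 Hey Hvp; rewrite -uE => L1u.
  have := uL (idx h); rewrite /Lop L1u /L0op ext_idx // mxE => <-.
  by ring.
have gB : sq g <= C * (2 `^ (2 * (k%:R - p%:R)) * N%:R `^ (2 * (p%:R - k%:R)) * nrm2 k%:R u).
  apply: (sq_le (u := L1op a p v)) => [h|]; first by rewrite mxE.
  by have := HC.2 _ _ Hv; rewrite powR_half // -mulrN opprB.
(* The growth N^(2(k-p)) of the squared resolvent bound on the circle cancels the decay N^(2(p-k))
   of [sq g]. *)
have bound : sq y <= eps ^+ 2 * K3.
  apply: (resolvent_maximum (delta0 N) nz _ yg) => z x zd xg.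
  have Hinv : (inv_norm cst 0 0 (idK c q k a p zeta z) * (N%:R `^ (p%:R - k%:R))%:E <=
      eps%:E)%E.
    apply: le_trans (HN1 N _); last by clear -NN; lia.
    apply: lee_wpmul2r; first by rewrite lee_fin powR_ge0.
    by apply: ereal_sup_ubound; exists z.
  have := circle_bound N0 e10 ga0 He1 Hn0 HC nN x eps0 epsK2 Hinv.
  rewrite xg => /le_trans; apply.
  have PP : N%:R `^ (2 * (k%:R - p%:R)) * N%:R `^ (2 * (p%:R - k%:R)) = 1 :> R.
    by rewrite -powRDp // -mulrDr addrA subrK subrr mulr0 powRr0.
  apply: (@le_trans _ _ (8 * eps ^+ 2 * e1 ^- 2 * N%:R `^ (2 * (k%:R - p%:R)) *
    (C * (2 `^ (2 * (k%:R - p%:R)) * N%:R `^ (2 * (p%:R - k%:R)) * nrm2 k%:R u)))).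
    by rewrite ler_wpM2l // !mulr_ge0 ?powR_ge0 ?invr_ge0 ?sqr_ge0 ?(ltW E1) ?(ltW e10).
  rewrite [leLHS](_ : _ = eps ^+ 2 * K3 * (N%:R `^ (2 * (k%:R - p%:R)) *
    N%:R `^ (2 * (p%:R - k%:R)))); last by rewrite /K3; ring.
  by rewrite PP mulr1.
have : U <= sq y.
  have [h jh] := inPN_idxs N0 j0N.
  rewrite /sq (bigD1 h) //= mxE -jh lerDl sumr_ge0 // => h' _; exact: sqr_ge0.
by move=> /le_trans /(_ bound); rewrite leNgt epsK3.
Qed.

End PartTwo.

Theorem theoremt (R : realType) (cst : R -> R) (k p q l : nat)
  (c : nat -> R[i]) (a : nat -> seqZ R) (zeta : R[i]) :
  (forall r : R, 0 < cst r) ->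
  (1 <= k)%N -> (p < k)%N -> (q <= k)%N -> (1 <= l)%N ->
  c k != 0 ->
  (forall d, (d <= p)%N -> inH l%:R (a d)) ->
  (forall m : int, zeta != symb c q k m) ->
  (* (1) *)
  (forall s : R, Num.min 0 (- l%:R + p%:R) <= s <= Num.max (2 * p%:R) (p%:R + l%:R) ->
    exists cc : R, forall eps : R, 0 < eps ->
      forall N : nat, (0 < N)%N -> cc * eps `^ (1 / (p%:R - k%:R)) < N%:R ->
        forall lam, fin_eig c q k a p N lam -> pseudospec cst c q k a p s eps lam)
  /\
  (* (2) *)
  (forall lam : R[i], isolated_eig cst c q k a p lam ->
    forall delta : nat -> R, (forall N, 0 < delta N) ->
      (exists B : R, forall N, delta N <= B) ->
      (exists t : R, 0 <= t <= k%:R + l%:R /\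
        small_o1 (fun N => (maxK cst c q k a p zeta lam (delta N) 0
                            * (N%:R `^ (p%:R - k%:R))%:E)%E) /\
        small_o1 (fun N => ((delta N)%:E * maxK cst c q k a p zeta lam (delta N) 0
                            * maxK cst c q k a p zeta lam (delta N) t
                            * (N%:R `^ (- t) * (cabs lam + 1) `^ ((Num.ceil (t / (k%:R - p%:R)))%:~R))%:E)%E)) ->
      exists N0 : nat, forall N : nat, (N0 < N)%N ->
        exists lamN, fin_eig c q k a p N lamN /\ cabs (lam - lamN) <= delta N).
Proof.
move=> cst0 k1 pk qk l1 ck Ha Hz; split=> [s _|lam [Hu _] delta delta0 _ [t [_ [Ho _]]]].
  exact: (eigenvalues_in_pseudospec cst0 k1 pk qk ck s l1 Ha).
apply: (eigenvalue_approximation cst0 k1 pk qk ck) => // d dp.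
by apply: inH_mono (Ha d dp); rewrite ler1n.
Qed.
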